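(* Let $\omega\in[0,N]$ and $\xi\in\Xi_N$. (a) If $\omega\in[0,N]\setminus\mathbb Z$, then $\mathcal A_\omega(\cdot\,;2\pi)$ attains its minimum on the set of loops in $\Lambda^{D_N}_\xi$ satisfying $[z_0]=0$. (b) If $\omega\in\{0,N\}$, then $\mathcal A_\omega(\cdot\,;2\pi)$ attains its minimum on the set of loops in $\Lambda^{D_N}_\xi$ satisfying $[x_0]=0$ and $[z_0]=0$.
   Context: Fix an integer $N\ge2$ and let $\mathbf N=\{0,\dots,N-1\}$. Consider unit masses with positions $q_i=(x_i,y_i,z_i)\in\mathbb R^3$, and write $\zeta_i=x_i+\mathrm i y_i\in\mathbb C$, so that $q_i=(\zeta_i,z_i)$. - Potential: $U(q)=\sum_{i<j}1/|q_i-q_j|$. - Collision set: $\Delta=\{q:q_i=q_j\text{ for some }i\ne j\}$. - Loop space: $\Lambda=H^1(\mathbb R/2\pi\mathbb Z,\mathbb R^{3N})$. - Rotating-frame action: for $\omega\in\mathbb R$, $\mathcal A_\omega(q;T_1,T_2)=\int_{T_1}^{T_2}\big(\tfrac12\sum_i(|\dot\zeta_i+\mathrm i\omega\zeta_i|^2+\dot z_i^2)+U(q)\big)dt$, and $\mathcal A_\omega(q;T)=\mathcal A_\omega(q;0,T)$. (This is the action in a frame rotating about the $z$-axis with angular velocity $\omega$.) - Means: $[x_0]=\frac1{2\pi}\int_0^{2\pi}x_0$ and $[z_0]=\frac1{2\pi}\int_0^{2\pi}z_0$. - Reflection: $\mathfrak R_{xz}(x,y,z)=(x,-y,z)$. -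 $D_N$-symmetric loops: $\Lambda^{D_N}=\{q\in\Lambda: q_i(t)=q_0(t+2\pi i/N),\ q_0(2\pi-t)=\mathfrak R_{xz}q_0(t)\ \forall t\}$. - Sign data: for collision-free $q\in\Lambda^{D_N}$, $y_0(k\pi/N)\ne0$ for $k=1,\dots,N-1$. Let $\Xi_N=\{\pm1\}^{N-1}$. - Topological classes: $\Lambda^{D_N}_\xi$ is the weak $H^1$-closure in $\Lambda^{D_N}$ of the collision-free $q\in\Lambda^{D_N}$ with $\operatorname{sign}y_0(k\pi/N)=\xi_k$ for all $k$. *)

(* Defs.v *)
From HB Require Import structures.
From mathcomp Require Import all_boot all_order all_algebra.
From mathcomp Require Import all_classical all_reals all_analysis.
Set Implicit Arguments. Unset Strict Implicit. Unset Printing Implicit Defensive.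
Import Order.TTheory GRing.Theory Num.Theory.
Import numFieldNormedType.Exports.
Local Open Scope classical_set_scope.
Local Open Scope ring_scope.

Section Defs.
Variables (R : realType) (N : nat).

(* A configuration: body i, coordinate k (k = 0:x, 1:y, 2:z). *)
Definition config := 'I_N -> 'I_3 -> R.
Definition path := R -> config.

Definition cx : 'I_3 := @Ordinal 3 0 erefl.
Definition cy : 'I_3 := @Ordinal 3 1 erefl.
Definition cz : 'I_3 := @Ordinal 3 2 erefl.

Definition T2pi : R := 2 * pi.
Definition I0 : set R := `[0, T2pi].
Definition leb := (@lebesgue_measure R).

Definition is_H1_deriv (q v : path) : Prop :=
  forall i k,
    measurable_fun I0 (fun t => v t i k) /\
    leb.-integrable I0 (fun t => (v t i k)%:E) /\
    leb.-integrable I0 (fun t => ((v t i k) ^+ 2)%:E) /\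
    forall s t, 0 <= s -> s <= t -> t <= T2pi ->
      (\int[leb]_(u in `[s, t]) (v u i k)%:E = (q t i k - q s i k)%:E)%E.

(* The loop space Lambda = H^1(R/2piZ, R^{3N}) (continuous representatives,
   extended 2pi-periodically to R). *)
Definition in_Lambda (q : path) : Prop :=
  (forall t, q (t + T2pi) = q t) /\ exists v, is_H1_deriv q v.

Definition dist (c : config) (i j : 'I_N) : R :=
  Num.sqrt (\sum_(k < 3) (c i k - c j k) ^+ 2).

Definition Upot (c : config) : \bar R :=
  (\sum_(i < N) \sum_(j < N | (i < j)%N)
     (if dist c i j == 0%R then +oo else ((dist c i j)^-1)%:E))%E.

(* kinetic integrand in the rotating frame, zeta_i = x_i + i y_i:
   |zeta_i' + i w zeta_i|^2 + z_i'^2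
   = (x_i' - w y_i)^2 + (y_i' + w x_i)^2 + z_i'^2 *)
Definition kin (w : R) (c dc : config) : R :=
  \sum_(i < N) ((dc i cx - w * c i cy) ^+ 2 + (dc i cy + w * c i cx) ^+ 2
                + (dc i cz) ^+ 2).

(* A_w(q; 2pi), where v is the (a.e.-defined) derivative of q. *)
Definition action (w : R) (q v : path) : \bar R :=
  (\int[leb]_(t in I0) ((2^-1 * kin w (q t) (v t))%:E + Upot (q t)))%E.

Definition H1inner (q v h w : path) : \bar R :=
  (\int[leb]_(t in I0)
     (\sum_(i < N) \sum_(k < 3) (q t i k * h t i k + v t i k * w t i k))%:E)%E.

Definition in_LambdaDN (q : path) : Prop :=
  in_Lambda q /\
  (forall i j : 'I_N, nat_of_ord j = 0%N ->
      forall t, q t i = q (t + T2pi * (nat_of_ord i)%:R / N%:R) j) /\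
  (forall j : 'I_N, nat_of_ord j = 0%N -> forall t,
      q (T2pi - t) j cx = q t j cx /\
      q (T2pi - t) j cy = - q t j cy /\
      q (T2pi - t) j cz = q t j cz).

Definition collision_free (q : path) : Prop :=
  forall t (i j : 'I_N), i != j -> exists k, q t i k != q t j k.

(* sign data xi : 'I_(N-1) -> R with values +-1; xi k encodes xi_{k+1}. *)
Definition sign_datum (xi : 'I_N.-1 -> R) : Prop :=
  forall k, xi k = 1 \/ xi k = -1.

Definition has_signs (xi : 'I_N.-1 -> R) (q : path) : Prop :=
  forall (j : 'I_N) (k : 'I_N.-1), nat_of_ord j = 0%N ->
    Num.sg (q ((nat_of_ord k).+1%:R * pi / N%:R) j cy) = xi k.

(* Weak closure in H^1: every weak neighbourhood (given by finitely many
   continuous linear functionals, i.e. by Riesz, finitely many H^1 inner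
   products) of q meets S. *)
Definition weak_closure (S : set path) : set path :=
  fun q => exists v, is_H1_deriv q v /\
    forall (m : nat) (h hd : 'I_m -> path) (eps : R), 0 < eps ->
      (forall j, in_Lambda (h j) /\ is_H1_deriv (h j) (hd j)) ->
      exists p u, S p /\ is_H1_deriv p u /\
        forall j, (`| H1inner (fun t i k => (q t i k - p t i k)%R)
                        (fun t i k => (v t i k - u t i k)%R) (h j) (hd j) |
                   < eps%:E)%E.

Definition LambdaDN_xi (xi : 'I_N.-1 -> R) : set path :=
  fun q => in_LambdaDN q /\
    weak_closure (fun p => in_LambdaDN p /\ collision_free p /\ has_signs xi p) q.

Definition mean (f : R -> R) : R := T2pi^-1 * Rintegral leb I0 f.

Definition attains_min_on (w : R) (S : set path) : Prop :=
  exists q0 v0, S q0 /\ is_H1_deriv q0 v0 /\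
    forall q v, S q -> is_H1_deriv q v -> (action w q0 v0 <= action w q v)%E.

Definition mean0_zero (k : 'I_3) (q : path) : Prop :=
  forall j : 'I_N, nat_of_ord j = 0%N -> mean (fun t => q t j k) = 0.

End Defs.

(* Main.v *)
(** The direct method. A minimising sequence is bounded in H^1: if [G] is a
    primitive of [zeta' + i w zeta], then [psi = zeta - G] is C^1 and
    [(e^{iwt} psi)' = - i w e^{iwt} G] is bounded, so that [e^{iwt} zeta(t)]
    stays within a fixed distance of [zeta(0)]. Body 0 has [y(0) = 0], and
    [x(0)] is controlled by periodicity and [e^{2 pi i w} <> 1] if [w] is not an
    integer, and by the vanishing mean if [w = 0]. For [w = N] the action, the
    class and the constraints are all invariant under adding [c e^{-iNt}] to
    every body, which allows one to assume [x(0) = 0].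

    A limit exists uniformly along an ultrafilter (Ascoli), hence along a
    subsequence. The velocities converge weakly in L^2: elements of almost
    minimal norm in the midpoint hulls of the tails are Cauchy by the
    parallelogram law, and the limit is identified by its integrals over
    intervals. The kinetic part is weakly lower semicontinuous by convexity, the
    potential part by Fatou's lemma, and all the constraints are weakly closed.

    The classes are nonempty: they contain [q_0 = (cos t, sin t P(cos t), 0)]
    where [P] interpolates the signs at the nodes [cos (k pi / N)]. *)
Require Import Defs.
From HB Require Import structures.
From mathcomp Require Import all_boot all_order all_algebra.
From mathcomp Require Import all_classical all_reals all_analysis.
From mathcomp Require Import measurable_realfun ring lra.
Set Implicit Arguments. Unset Strict Implicit. Unset Printing Implicit Defensive.
Import Order.TTheory GRing.Theory Num.Theory.
Import numFieldNormedType.Exports.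
Local Open Scope classical_set_scope.
Local Open Scope ring_scope.

(** * Square integrable functions on a set of finite measure *)

Section SquareIntegrable.
Context (d : measure_display) (T : measurableType d) (R : realType).
Variables (mu : {measure set T -> \bar R}) (D : set T).
Hypotheses (mD : measurable D) (finD : (mu D < +oo)%E).

(** The kinetic term controls only the residual [zeta' + i w zeta], which does not see the mode
    [c e^{-iwt}]. Up to a bounded error this mode is all that coercivity has to exclude, with [c]
    real because of the reflection. It is not a loop if [w] is not an integer, and it is a constant
    if [w = 0]. For [w = N] it is a symmetric loop with vanishing means, so that no constraint
    bounds it and minimising sequences have to be moved along it. For other integers the mode is
    excluded by none of these means.

    Collisions cost nothing: the potential is [+oo] there and continuous as an extended function,
    and if the infimum is [+oo] every loop of the class is a minimiser. Hence the action of the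
    explicit loop is never estimated. A single notion of convergence, [uw_cvg], is what compactness
    delivers and what semicontinuity and closedness consume. The choreography symmetry reduces all
    estimates to body 0. *)

Definition sqint (f : T -> R) : Prop :=
  measurable_fun D f /\ mu.-integrable D (EFin \o (fun x => f x ^+ 2)).

(** Functions equal almost everywhere are not identified, so this form is only semidefinite; weak
    derivatives are therefore compared through their pairings. *)
Definition ip (f g : T -> R) : R := Rintegral mu D (fun x => f x * g x).

Lemma integrable_cst_fin (c : R) : mu.-integrable D (EFin \o cst c).
Proof.
apply: measurable_bounded_integrable => //.
exact: bounded_cst.
Qed.

Lemma sqintM f g : sqint f -> sqint g ->
  mu.-integrable D (EFin \o (fun x => f x * g x)).
Proof.
move=> [mf f2] [mg g2].
apply: (le_integrable mD _ _ (integrableD mD f2 g2)).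
  by apply/measurable_EFinP; exact: measurable_funM.
move=> x Dx /=; rewrite lee_fin.
rewrite [leRHS]ger0_norm ?addr_ge0 ?sqr_ge0//.
by rewrite ler_norml; apply/andP; split; nra.
Qed.

Lemma sqint_cst c : sqint (cst c).
Proof.
split; first exact: measurable_cst.
exact: (integrable_cst_fin (c ^+ 2)).
Qed.

Lemma sqint_integrable f : sqint f -> mu.-integrable D (EFin \o f).
Proof.
move=> /sqintM /(_ (sqint_cst 1)); congr (integrable _ _ _).
by apply/funext => x /=; rewrite mulr1.
Qed.

Lemma sqintD f g : sqint f -> sqint g -> sqint (fun x => f x + g x).
Proof.
move=> sf sg; have [mf f2] := sf; have [mg g2] := sg.
split; first exact: measurable_funD.
have := integrableD mD (integrableD mD f2 g2) (integrableZl mD 2 (sqintM sf sg)).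
by congr (integrable _ _ _); apply/funext => x /=; congr EFin; ring.
Qed.

Lemma sqintZ c f : sqint f -> sqint (fun x => c * f x).
Proof.
move=> [mf f2]; split; first exact: measurable_funM.
have := integrableZl mD (c ^+ 2) f2.
by congr (integrable _ _ _); apply/funext => x /=; congr EFin; ring.
Qed.

Lemma sqintN f : sqint f -> sqint (fun x => - f x).
Proof.
move=> /(sqintZ (-1)); congr sqint.
by apply/funext => x; rewrite mulN1r.
Qed.

Lemma sqintB f g : sqint f -> sqint g -> sqint (fun x => f x - g x).
Proof. by move=> sf sg; exact: sqintD sf (sqintN sg). Qed.

Lemma sqint_bounded (f : T -> R) (M : R) : measurable_fun D f ->
  (forall x, D x -> `|f x| <= M) -> sqint f.
Proof.
move=> mf fM; split=> //.
apply: (le_integrable mD _ _ (integrable_cst_fin (M ^+ 2))).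
  by apply/measurable_EFinP; exact: measurable_funX.
move=> x Dx /=; rewrite lee_fin !ger0_norm ?sqr_ge0//.
have := fM x Dx; rewrite -[f x ^+ 2]real_normK ?num_real// => h.
by rewrite ler_sqr ?nnegrE// (le_trans _ h).
Qed.

Lemma ipC f g : ip f g = ip g f.
Proof. by apply: eq_Rintegral => x _; rewrite mulrC. Qed.

Lemma ipDl f g h : sqint f -> sqint g -> sqint h ->
  ip (fun x => f x + g x) h = ip f h + ip g h.
Proof.
move=> sf sg sh; rewrite /ip -RintegralD//; [|exact: sqintM..].
by apply: eq_Rintegral => x _; rewrite mulrDl.
Qed.

Lemma ipZl c f h : sqint f -> sqint h -> ip (fun x => c * f x) h = c * ip f h.
Proof.
move=> sf sh; rewrite /ip -RintegralZl//; last exact: sqintM.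
by apply: eq_Rintegral => x _; rewrite mulrA.
Qed.

Lemma ipNl f h : sqint f -> sqint h -> ip (fun x => - f x) h = - ip f h.
Proof.
move=> sf sh; rewrite -mulN1r -ipZl//; congr ip.
by apply/funext => x; rewrite mulN1r.
Qed.

Lemma ipNr f h : sqint f -> sqint h -> ip f (fun x => - h x) = - ip f h.
Proof. by move=> sf sh; rewrite ipC ipNl// ipC. Qed.

Lemma ipBl f g h : sqint f -> sqint g -> sqint h ->
  ip (fun x => f x - g x) h = ip f h - ip g h.
Proof. by move=> sf sg sh; rewrite ipDl ?ipNl//; exact: sqintN. Qed.

Lemma ip_ge0 f : 0 <= ip f f.
Proof. by apply: Rintegral_ge0 => x _; rewrite -expr2 sqr_ge0. Qed.

Lemma ipDD f g : sqint f -> sqint g ->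
  ip (fun x => f x + g x) (fun x => f x + g x) = ip f f + 2 * ip f g + ip g g.
Proof.
move=> sf sg; have sfg := sqintD sf sg.
rewrite ipDl// (ipC f (fun x => f x + g x)) (ipC g (fun x => f x + g x)).
by rewrite !ipDl// (ipC g f); ring.
Qed.

Lemma ipBB f g : sqint f -> sqint g ->
  ip (fun x => f x - g x) (fun x => f x - g x) = ip f f - 2 * ip f g + ip g g.
Proof.
move=> sf sg; have sN := sqintN sg.
rewrite ipDD// (ipC f (fun x => - g x)) (ipNl sg sf) (ipNl sg sN) (ipC g (fun x => - g x)) ipNl//.
by rewrite (ipC g f); ring.
Qed.

Lemma ip_cauchy_schwarz f g : sqint f -> sqint g ->
  ip f g ^+ 2 <= ip f f * ip g g.
Proof.
move=> sf sg.
have H t : 0 <= ip f f + 2 * (t * ip f g) + t ^+ 2 * ip g g.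
  have := ip_ge0 (fun x => f x + t * g x).
  have stg := sqintZ t sg.
  rewrite ipDD// (ipZl _ sg stg) (ipC f (fun x => t * g x)) ipZl//.
  by rewrite (ipC g (fun x => t * g x)) ipZl// (ipC g f) [t * (t * _)]mulrA -expr2.
have [g0|g0] := eqVneq (ip g g) 0.
  have [->|fg0] := eqVneq (ip f g) 0; first by rewrite expr0n mulr_ge0 ?ip_ge0.
  (* The quadratic polynomial has become affine with nonzero slope, and takes the value -1 here. *)
  have := H (- (ip f f + 1) / (2 * ip f g)); rewrite g0 mulr0 addr0.
  rewrite (_ : 2 * _ = - (ip f f + 1)); last by field.
  by move=> h; exfalso; lra.
have gp : 0 < ip g g by rewrite lt0r g0 ip_ge0.
have := H (- ip f g / ip g g).
rewrite (_ : _ + _ = (ip f f * ip g g - ip f g ^+ 2) / ip g g); last by field.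
by rewrite pmulr_lge0 ?invr_gt0// subr_ge0.
Qed.

End SquareIntegrable.

Section FatouBound.
Context (d : measure_display) (T : measurableType d) (R : realType).
Variables (mu : {measure set T -> \bar R}) (D : set T).
Hypothesis mD : measurable D.

(** Fatou's lemma with a convergent sequence of bounds. It serves twice: for the limit in the
    completeness proof, where convergence holds only almost everywhere, and for the potential. *)
Lemma integral_le_ae_cvg (F : nat -> T -> \bar R) (G : T -> \bar R)
    (c : nat -> R) (l : R) :
  (forall n, measurable_fun D (F n)) ->
  (forall n x, D x -> (0 <= F n x)%E) ->
  measurable_fun D G ->
  {ae mu, forall x, D x -> F n x @[n --> \oo] --> G x} ->
  c @ \oo --> l ->
  (\forall n \near \oo, (\int[mu]_(x in D) F n x <= (c n)%:E)%E) ->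
  (\int[mu]_(x in D) G x <= l%:E)%E.
Proof.
move=> mF F0 mG FG cl Fc.
have mI : measurable_fun D (fun x => limn_einf (F ^~ x)).
  rewrite (_ : (fun x => _) = -%E \o (fun x => limn_esup (fun n => - F n x)%E)).
    apply: measurableT_comp => //.
    by apply: measurable_fun_limn_esup => n; apply: measurableT_comp => //; exact: mF.
  by apply/funext => x.
rewrite (@ae_eq_integral _ _ _ mu D (fun x => limn_einf (F ^~ x)))//; last first.
  by apply: filterS FG => x FG Dx; have [-> _] := cvg_limn_einf_sup (FG Dx).
apply: (le_trans (fatou mu mD mF F0)).
rewrite limn_einf_lim.
have cvc : (c n)%:E @[n --> \oo] --> l%:E by apply: cvg_EFin; [exact: nearW|].
rewrite -(cvg_lim _ cvc)//.
apply: lee_lim; [exact: is_cvg_einfs|by apply/cvg_ex; exists l%:E|].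
apply: filterS Fc => n; apply: le_trans.
by apply: ereal_inf_lbound; exists n => /=.
Qed.

End FatouBound.

(** * Completeness of the space of square integrable functions *)

Section Completeness.
Context (d : measure_display) (T : measurableType d) (R : realType).
Variables (mu : {measure set T -> \bar R}) (D : set T).
Hypotheses (mD : measurable D) (finD : (mu D < +oo)%E).

Local Notation sqint := (sqint mu D).
Local Notation ip := (ip mu D).
Local Notation nrm2 f := (ip f%R f%R).

Lemma ip_EFin f g : sqint f -> sqint g ->
  (ip f g)%:E = (\int[mu]_(x in D) (f x * g x)%:E)%E.
Proof.
move=> sf sg; rewrite /ip /Rintegral fineK//.
exact: (integrable_fin_num mD (sqintM mD sf sg)).
Qed.

Variable g : nat -> T -> R.
Hypothesis sg : forall n, sqint (g n).
Hypothesis cg : forall n m, (n <= m)%N ->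
  nrm2 (fun x => g m x - g n x) <= 4^-1 ^+ n.

Let inc k x : R := `|g k.+1 x - g k x|.

Let minc k : measurable_fun D (inc k).
Proof.
by apply: measurableT_comp => //; apply: measurable_funB; apply sg.
Qed.

(** Expanding [(1 - c a)^2 >= 0] with [c = 2^k] gives [a <= 1/(2c) + c a^2 / 2]. As the integral of
    [a^2] is at most [4^-k], both terms are of order [2^-(k+1)], hence summable. *)
Let int_inc k : (\int[mu]_(x in D) (inc k x)%:E <=
  ((fine (mu D) + 1) / (2 ^ k.+1)%:R)%:E)%E.
Proof.
have sd : sqint (fun x => g k.+1 x - g k x) by exact: sqintB.
have c2 : 0 < 2 ^+ k :> R by rewrite exprn_gt0.
have intR : mu.-integrable D (EFin \o
    (fun x => (2 ^+ k.+1)^-1 + 2 ^+ k / 2 * ((g k.+1 x - g k x) * (g k.+1 x - g k x)))).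
  apply: (@integrableD _ _ _ mu D mD (EFin \o cst (2 ^+ k.+1)^-1)
    (fun x => (2 ^+ k / 2)%:E * ((g k.+1 x - g k x) * (g k.+1 x - g k x))%:E)%E).
    exact: integrable_cst_fin.
  by apply: integrableZl => //; exact: sqintM.
apply: (@le_trans _ _ (\int[mu]_(x in D) ((2 ^+ k.+1)^-1 +
   2 ^+ k / 2 * ((g k.+1 x - g k x) * (g k.+1 x - g k x)))%:E)%E).
  apply: ge0_le_integral => //.
  - by move=> x _; rewrite lee_fin normr_ge0.
  - by apply/measurable_EFinP; exact: minc.
  - by case/integrableP : intR.
  move=> x Dx; rewrite lee_fin /inc.
  set u := g k.+1 x - g k x.
  rewrite -[u * u]expr2 -[u ^+ 2]real_normK ?num_real// exprS invfM.
  set a := `|u|; set c := 2 ^+ k.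
  have c0 : 0 < c by [].
  rewrite -subr_ge0 (_ : _ - _ = (1 - c * a) ^+ 2 / (2 * c)).
    by rewrite divr_ge0 ?sqr_ge0// mulr_ge0// ltW.
  by field; rewrite gt_eqF.
rewrite -[leLHS]fineK ?(integrable_fin_num mD intR)//.
rewrite lee_fin -/(Rintegral _ _ _).
rewrite (@RintegralD _ _ _ mu D (fun=> (2 ^+ k.+1)^-1)
  (fun x => 2 ^+ k / 2 * ((g k.+1 x - g k x) * (g k.+1 x - g k x))))//; last 2 first.
  exact: integrable_cst_fin.
  exact: (integrableZl mD (2 ^+ k / 2) (sqintM mD sd sd)).
rewrite Rintegral_cst// RintegralZl//; last exact: sqintM.
have := cg (leqnSn k); rewrite /ip => h.
rewrite mulrC mulrDl natrX lerD2l mul1r.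
apply: (@le_trans _ _ (2 ^+ k / 2 * 4^-1 ^+ k)).
  by rewrite ler_wpM2l// divr_ge0// ltW.
rewrite (_ : 4 = 2 * 2 :> R); last by rewrite -natrM.
rewrite exprVn exprMn exprS le_eqVlt; apply/orP; left; apply/eqP.
by field; rewrite gt_eqF.
Qed.

(** The sum of the increments has finite integral, so it is finite almost everywhere, and there the
    telescoping series converges absolutely. *)
Let cvg_ae : {ae mu, forall x, D x -> cvgn (g ^~ x)}.
Proof.
pose H x := (\sum_(k <oo) (inc k x)%:E)%E.
have mH : measurable_fun D H.
  apply: ge0_emeasurable_sum => // k *; first by rewrite lee_fin normr_ge0.
  by apply/measurable_EFinP; exact: minc.
have H0 x : (0 <= H x)%E by apply: nneseries_ge0 => n *; rewrite lee_fin normr_ge0.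
have iH : mu.-integrable D H.
  apply/integrableP; split => //.
  under eq_integral do rewrite gee0_abs//.
  rewrite integral_nneseries//; last 2 first.
  - by move=> k; apply/measurable_EFinP; exact: minc.
  - by move=> *; rewrite lee_fin normr_ge0.
  apply: (@le_lt_trans _ _ (fine (mu D) + 1)%:E); last exact: ltry.
  apply: le_trans (epsilon_trick0 xpredT _); last first.
    by rewrite addr_ge0// fine_ge0.
  apply: lee_nneseries => [k *|k _]; last exact: int_inc.
  by apply: integral_ge0 => *; rewrite lee_fin normr_ge0.
apply: filterS (integrable_ae mD iH) => x Hfin Dx.
have {}Hfin := Hfin Dx.
have : cvgn (series (telescope (g ^~ x)) : nat -> R^o).
  apply: (@normed_cvg R R^o); apply: nondecreasing_is_cvgn.
    by apply: nondecreasing_series => n *; exact: normr_ge0.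
  exists (fine (H x)) => _ [n _ <-].
  rewrite -lee_fin fineK//.
  apply: le_trans (nneseries_lim_ge n _).
    by rewrite sumEFin lee_fin.
  by move=> *; rewrite lee_fin normr_ge0.
move=> cs.
rewrite (_ : g ^~ x = (fun n => g 0%N x + series (telescope (g ^~ x)) n)).
  exact: is_cvgD (is_cvg_cst _) cs.
by apply/funext => n; rewrite -eq_sum_telescope.
Qed.

Lemma sqint_complete : exists f, sqint f /\
  forall n, nrm2 (fun x => f x - g n x) <= 4^-1 ^+ n.
Proof.
(* An upper limit is measurable without further ado and agrees with the limit wherever that exists;
   elsewhere any value will do. *)
pose f x := fine (limn_esup (fun k => (g k x)%:E)).
have mf : measurable_fun D f.
  apply: measurableT_comp => //.
  by apply: measurable_fun_limn_esup => n; apply/measurable_EFinP; apply sg.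
have fE : {ae mu, forall x, D x -> g n x @[n --> \oo] --> f x}.
  apply: filterS cvg_ae => x cx Dx.
  have {}cx := cx Dx.
  have h : (g n x)%:E @[n --> \oo] --> (limn (g ^~ x))%:E.
    by apply: cvg_EFin; [exact: nearW|].
  by rewrite /f; have [_ ->] := cvg_limn_einf_sup h.
have key n : (\int[mu]_(x in D) ((f x - g n x) ^+ 2)%:E <= (4^-1 ^+ n)%:E)%E.
  apply: (@integral_le_ae_cvg _ _ _ mu D mD (fun m x => ((g m x - g n x) ^+ 2)%:E)
    _ (fun=> 4^-1 ^+ n)).
  - move=> m; apply/measurable_EFinP; apply: measurable_funX.
    by apply: measurable_funB; apply sg.
  - by move=> m x _; rewrite lee_fin sqr_ge0.
  - apply/measurable_EFinP; apply: measurable_funX.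
    by apply: measurable_funB => //; apply sg.
  - apply: filterS fE => x fE Dx; apply: cvg_EFin; first exact: nearW.
    have h : g m x - g n x @[m --> \oo] --> f x - g n x.
      by apply: cvgB; [exact: fE|exact: cvg_cst].
    by rewrite expr2; under eq_fun do rewrite expr2; exact: cvgM.
  - exact: cvg_cst.
  - exists n => // m /= nm.
    under eq_integral do rewrite expr2.
    rewrite -ip_EFin ?lee_fin; [exact: cg|exact: sqintB..].
have sfg n : sqint (fun x => f x - g n x).
  have mfg : measurable_fun D (fun x => f x - g n x).
    by apply: measurable_funB => //; apply sg.
  split=> //; apply/integrableP; split.
    by apply/measurable_EFinP; exact: measurable_funX.
  apply: le_lt_trans (ltry (4^-1 ^+ n)); apply: le_trans (key n).
  by under eq_integral do rewrite gee0_abs ?lee_fin ?sqr_ge0//.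
exists f; split.
  have := sqintD mD (sfg 0%N) (sg 0%N); congr sqint.
  by apply/funext => x; rewrite subrK.
move=> n; rewrite -lee_fin ip_EFin//.
by under eq_integral do rewrite -expr2; exact: key.
Qed.

End Completeness.

(** * Weak compactness of bounded sequences in L^2 *)

Section Mazur.
Context (d : measure_display) (T : measurableType d) (R : realType).
Variables (mu : {measure set T -> \bar R}) (D : set T).
Hypotheses (mD : measurable D) (finD : (mu D < +oo)%E).

Local Notation sqint := (sqint mu D).
Local Notation ip := (ip mu D).
Local Notation nrm2 f := (ip f%R f%R).

(** The dyadic convex combinations of a tail. Midpoints are all that the parallelogram law asks for,
    and they spare any bookkeeping of weights. *)
Inductive midhull (F : nat -> T -> R) (n : nat) : (T -> R) -> Prop :=
| midhull_base m : (n <= m)%N -> midhull F n (F m)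
| midhull_mid f g : midhull F n f -> midhull F n g ->
    midhull F n (fun x => 2^-1 * (f x + g x)).

Lemma midhull_anti F n m f : (n <= m)%N -> midhull F m f -> midhull F n f.
Proof.
move=> nm; elim=> [k mk|f1 g1 _ h1 _ h2]; last exact: midhull_mid.
by apply: midhull_base; exact: leq_trans mk.
Qed.

Lemma midhull_sqint F n f : (forall k, sqint (F k)) -> midhull F n f -> sqint f.
Proof.
move=> sF; elim=> [k _|f1 g1 _ s1 _ s2]; first exact: sF.
exact/sqintZ/sqintD.
Qed.

Lemma midhull_ip_ge F n f h c : (forall k, sqint (F k)) -> sqint h ->
  (forall k, (n <= k)%N -> c <= ip (F k) h) -> midhull F n f -> c <= ip f h.
Proof.
move=> sF sh cF; elim=> [k|f1 g1 m1 h1 m2 h2]; first exact: cF.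
have s1 := midhull_sqint sF m1; have s2 := midhull_sqint sF m2.
by rewrite ipZl ?ipDl//; [lra|exact: sqintD].
Qed.

Lemma nrm2_midpoint f g : sqint f -> sqint g ->
  nrm2 (fun x => f x - g x) = 2 * nrm2 f + 2 * nrm2 g
    - 4 * nrm2 (fun x => 2^-1 * (f x + g x)).
Proof.
move=> sf sg; have sD := sqintD mD sf sg.
have sh := sqintZ mD 2^-1 sD.
rewrite (ipZl _ _ sD sh)// (ipC _ _ (fun x => f x + g x)) ipZl//.
by rewrite ipBB// ipDD//; field.
Qed.

(* By the parallelogram law, elements of almost minimal norm in the hulls of
   the tails form a Cauchy sequence; its limit lies in every half-space
   containing a tail. *)
Lemma weak_cluster F (C : R) : (forall n, sqint (F n)) ->
  (forall n, nrm2 (F n) <= C) ->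
  exists f, sqint f /\ forall h c, sqint h ->
    (\forall n \near \oo, c <= ip (F n) h) -> c <= ip f h.
Proof.
move=> sF FC.
pose E n := [set nrm2 f | f in midhull F n].
have E0 n : has_inf (E n).
  split; first by exists (nrm2 (F n)), (F n) => //; exact: midhull_base.
  by exists 0 => _ [f _ <-]; exact: ip_ge0.
have Elb n f : midhull F n f -> inf (E n) <= nrm2 f.
  by move=> nf; apply: ge_inf; [case: (E0 n)|exists f].
have Emono n m : (n <= m)%N -> inf (E n) <= inf (E m).
  move=> nm; apply: lb_le_inf; first by case: (E0 m).
  by move=> _ [f mf <-]; apply: Elb; exact: midhull_anti mf.
pose S := range (fun n => inf (E n)).
have S0 : has_sup S.
  split; first by exists (inf (E 0%N)), 0%N.
  exists C => _ [n _ <-]; apply: le_trans (FC n).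
  by apply: Elb; exact: midhull_base.
have ES n : inf (E n) <= sup S by apply: ub_le_sup; [case: S0|exists n].
(* The parallelogram law yields [2 (S + del n) + 2 (S + del m) - 4 (S - del n) <= 8 del n]; the
   factor 8 brings this to the rate required by [sqint_complete]. *)
pose del (k : nat) : R := 4^-1 ^+ k / 8.
have del0 k : 0 < del k by rewrite divr_gt0// exprn_gt0// invr_gt0.
have ex k : exists y : nat * (T -> R), [/\ (k <= y.1)%N, midhull F y.1 y.2,
    sup S - del k < inf (E y.1) & nrm2 y.2 < sup S + del k].
  have [_ [n _ <-] hn] := sup_adherent (del0 k) S0.
  have hn' : sup S - del k < inf (E (maxn n k)).
    by apply: lt_le_trans hn _; apply: Emono; exact: leq_maxl.
  have [_ [f mf <-] hf] := inf_adherent (del0 k) (E0 (maxn n k)).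
  exists (maxn n k, f); split => //=; first exact: leq_maxr.
  by apply: lt_le_trans hf _; rewrite lerD2r.
have [y yP] := choice ex.
pose g k := (y k).2.
have sg k : sqint (g k) by have [_ /(midhull_sqint sF)] := yP k.
have cg n m : (n <= m)%N -> nrm2 (fun x => g m x - g n x) <= 4^-1 ^+ n.
  move=> nm; rewrite nrm2_midpoint//.
  have [_ an bn cn] := yP n; have [_ am bm cm] := yP m.
  rewrite -/(g n) in an cn; rewrite -/(g m) in am cm.
  have dmn : del m <= del n.
    rewrite ler_pM2r ?invr_gt0//; apply: ler_wiXn2l => //.
    by rewrite invf_le1// ler1n.
  have : sup S - del n <= nrm2 (fun x => 2^-1 * (g m x + g n x)).
    (* The midpoint belongs to the hull of whichever tail starts earlier. *)
    have [le|/ltnW le] := leqP (y n).1 (y m).1.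
      apply: le_trans (ltW bn) _; apply: Elb; apply: midhull_mid => //.
      exact: midhull_anti am.
    apply: (@le_trans _ _ (inf (E (y m).1))); first lra.
    apply: Elb; apply: midhull_mid => //; exact: midhull_anti an.
  have -> : 4^-1 ^+ n = 8 * del n by rewrite /del; field.
  move: (ip _ _) (ip _ _) (ip _ _) cn cm => a b c; lra.
have [f [sf fg]] := sqint_complete mD finD sg cg.
exists f; split => // h c sh [n0 _ cF]; rewrite leNgt; apply/negP => lt.
pose e := c - ip f h.
have e0 : 0 < e by rewrite subr_gt0.
have key k : (n0 <= k)%N -> e ^+ 2 <= 4^-1 ^+ k * ip h h.
  move=> nk; have [ky myk _ _] := yP k.
  have cg' : c <= ip (g k) h.
    apply: (midhull_ip_ge sF sh _ myk) => j yj; apply: cF => /=.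
    exact: leq_trans nk (leq_trans ky yj).
  have sfg : sqint (fun x => f x - g k x) by exact: sqintB.
  apply: le_trans (_ : ip (fun x => f x - g k x) h ^+ 2 <= _).
    by rewrite ipBl// -[leRHS]sqrrN ler_sqr ?nnegrE; rewrite /e; lra.
  apply: le_trans (ip_cauchy_schwarz mD sfg sh) _.
  by rewrite ler_wpM2r ?ip_ge0.
have lim0 : 4^-1 ^+ k * ip h h @[k --> \oo] --> (0 * ip h h : R).
  apply: cvgM; last exact: cvg_cst.
  by apply: cvg_expr; rewrite ger0_norm ?invr_ge0// invf_lt1 ?ltr1n.
suff : e ^+ 2 <= 0 by rewrite leNgt exprn_gt0.
rewrite -(mul0r (ip h h)) -(cvg_lim _ lim0)//.
apply: limr_ge; first by apply/cvg_ex; eexists; exact: lim0.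
by exists n0 => // k /=; exact: key.
Qed.

(** Every subsequence has a weak cluster function taking the values [L] on the total family [H], and
    two such functions have equal pairings. A pairing staying away from its limit along a
    subsequence would persist in the cluster function of that subsequence. *)
Lemma weak_limit F (C : R) (H : set (T -> R)) (L : (T -> R) -> R) :
  (forall n, sqint (F n)) -> (forall n, nrm2 (F n) <= C) ->
  (forall h, H h -> sqint h) ->
  (forall f, sqint f -> (forall h, H h -> ip f h = 0) ->
     forall g, sqint g -> ip f g = 0) ->
  (forall h, H h -> ip (F n) h @[n --> \oo] --> L h) ->
  exists f, sqint f /\
    forall g, sqint g -> ip (F n) g @[n --> \oo] --> ip f g.
Proof.
move=> sF FC sH totH cvH.
(* Dominating the identity is enough for [phi] to preserve limits, so subsequences need not be
   increasing. *)
have cl (phi : nat -> nat) : (forall n, (n <= phi n)%N) ->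
    exists f, [/\ sqint f, forall h, H h -> ip f h = L h
    & forall h c, sqint h -> (forall n, c <= ip (F (phi n)) h) -> c <= ip f h].
  move=> phin.
  have [f [sf fP]] := weak_cluster (fun n => sF (phi n)) (fun n => FC (phi n)).
  exists f; split => // [h Hh|h c sh hc]; last by apply: fP => //; exact: nearW.
  have sh := sH h Hh.
  have cvp : ip (F (phi n)) h @[n --> \oo] --> L h.
    apply: (cvg_comp phi (fun n => ip (F n) h)) (cvH h Hh).
    by move=> A [N0 _ NA]; exists N0 => // n /= Nn; apply: NA => /=; exact: leq_trans (phin n).
  apply/eqP; rewrite eq_le; apply/andP; split; apply/ler_addgt0Pr => e e0.
    rewrite -lerN2 opprD -ipNr//; apply: fP; first exact: sqintN.
    move/cvgrPdist_lt : cvp => /(_ e e0); apply: filterS => n.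
    by rewrite ipNr// ltr_norml => /andP[? ?]; lra.
  rewrite -lerBlDr; apply: fP => //.
  move/cvgrPdist_lt : cvp => /(_ e e0); apply: filterS => n.
  by rewrite ltr_norml => /andP[? ?]; lra.
have [f [sf fH _]] := cl id leqnn.
exists f; split => //.
have side g e : sqint g -> 0 < e -> \forall n \near \oo, ip (F n) g < ip f g + e.
  move=> sg e0; apply: contrapT => nfar.
  have ex N0 : exists n, (N0 <= n)%N /\ ip f g + e <= ip (F n) g.
    apply: contrapT => none; apply: nfar; exists N0 => // n /= Nn.
    by rewrite ltNge; apply/negP => h; apply: none; exists n.
  have [phi phiP] := choice ex.
  have [f' [sf' fH' f'P]] := cl phi (fun n => (phiP n).1).
  have h1 : ip f g + e <= ip f' g by apply: f'P => // n; exact: (phiP n).2.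
  have : ip (fun x => f' x - f x) g = 0.
    apply: totH => //; first exact: sqintB.
    by move=> h Hh; rewrite ipBl ?fH ?fH' ?subrr//; exact: sH.
  by rewrite ipBl//; lra.
move=> g sg; apply/cvgrPdist_lt => e e0.
have := side _ _ (sqintN mD sg) e0; have := side _ _ sg e0.
apply: filterS2 => n h1; rewrite !ipNr// => h2.
by rewrite ltr_norml; apply/andP; split; lra.
Qed.

(** The squared norm lies above its tangent at [f]. The left side is affine in [g], so it passes to
    weak limits. *)
Lemma nrm2_lsc f g : sqint f -> sqint g ->
  nrm2 f + 2 * (ip g f - nrm2 f) <= nrm2 g.
Proof.
move=> sf sg; have := ip_ge0 mu D (fun x => g x - f x).
by rewrite ipBB//; lra.
Qed.

End Mazur.

(** * Totality of the indicators of intervals *)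

Section Indicators.
Context (R : realType).
Local Notation leb := (@lebesgue_measure R).

(** Extended by 0 to the line, [f] has a primitive from [-oo] that vanishes identically;
    differentiating it almost everywhere gives back [f]. *)
Lemma integral_itv0_ae_eq0 (a b : R) (f : R -> R) :
  leb.-integrable `[a, b] (EFin \o f) ->
  (forall s t, a <= s -> s <= t -> t <= b ->
     Rintegral leb `[s, t]%classic f = 0) ->
  {ae leb, forall x, `[a, b]%classic x -> f x = 0}.
Proof.
move=> intf f0.
pose g := f \_ `[a, b].
have intg : leb.-integrable setT (EFin \o g).
  rewrite -restrict_EFin.
  by apply: (proj1 (@integrable_mkcond _ _ _ leb `[a, b]%classic (EFin \o f) _) intf).
have locg := integrable_locally (measurable_itv `[a, b]) intf.
have intgy y : leb.-integrable `]-oo, y] (EFin \o g) by exact: integrableS intg.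
have F0 x : \int[leb]_(t in [set` `]-oo, x]]) g t = 0.
  rewrite /g -Rintegral_mkcondr.
  have [xa|ax] := ltP x a.
    rewrite (_ : _ `&` _ = set0) ?Rintegral_set0//.
    apply/seteqP; split => // t /=; rewrite !in_itv /= => -[tx /andP[at_ _]].
    by have := le_lt_trans (le_trans at_ tx) xa; rewrite ltxx.
  have [ab|ba] := leP a b; last first.
    rewrite (_ : _ `&` _ = set0) ?Rintegral_set0//.
    apply/seteqP; split => // t /=; rewrite !in_itv /= => -[tx /andP[at_ tb]].
    by have := lt_le_trans ba (le_trans at_ tb); rewrite ltxx.
  rewrite (_ : _ `&` _ = `[a, Num.min x b]%classic); last first.
    apply/seteqP; split => t /=; rewrite !in_itv /= le_min.
      by move=> [-> /andP[-> ->]].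
    by move=> /andP[-> /andP[-> ->]].
  by apply: f0 => //; rewrite ?le_min ?ax// ge_min lexx orbT.
have := FTC1Ny intgy locg.
apply: filterS; first exact: (ae_filter_ringOfSetsType leb).
move=> x [_].
rewrite (_ : (fun x => _) = cst 0); last by apply/funext => y; exact: F0.
rewrite derive1_cst => /esym + abx; rewrite /g patchE ifT//; exact/mem_set.
Qed.

Lemma indic_total (a b : R) (f g : R -> R) :
  sqint leb `[a, b]%classic f -> sqint leb `[a, b]%classic g ->
  (forall s t, a <= s -> s <= t -> t <= b -> Rintegral leb `[s, t]%classic f = 0) ->
  ip leb `[a, b]%classic f g = 0.
Proof.
move=> sf sg f0.
have mab : @measurable _ (measurableTypeR R) `[a, b]%classic by exact: measurable_itv.
have finab : (leb `[a, b]%classic < +oo)%E.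
  by rewrite lebesgue_measure_itv; case: ifP => _; rewrite ?ltry// -EFinB ltry.
have ae0 := integral_itv0_ae_eq0 (@sqint_integrable _ _ _ leb _ mab finab _ sf) f0.
have intfg := sqintM mab sf sg.
rewrite /ip /Rintegral (@ae_eq_integral _ _ _ leb _ (cst 0%E))//.
- by rewrite integral0.
- by case/integrableP : intfg.
- move: ae0; apply: filterS; first exact: (ae_filter_ringOfSetsType leb).
  by move=> x h /h ->; rewrite /= mul0r.
Qed.

End Indicators.

(** * Scalar H^1 functions on an interval *)

Section H1Scalar.
Context (R : realType) (T : R).
Hypothesis T0 : 0 < T.
Local Notation leb := (@lebesgue_measure R).
Local Notation J := (`[0, T]%classic : set (measurableTypeR R)).
Local Notation L2 := (sqint leb J).
Local Notation ip := (ip leb J).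
Local Notation nrm2 f := (ip f%R f%R).

Lemma measurable_J : measurable J. Proof. exact: measurable_itv. Qed.

Lemma finite_J : (leb J < +oo)%E.
Proof. by rewrite lebesgue_measure_itv /= lte_fin T0 -EFinB ltry. Qed.

Let mJ := measurable_J.
Let fJ := finite_J.

Definition h1d (f g : R -> R) : Prop := L2 g /\
  forall s t : R, 0 <= s -> s <= t -> t <= T ->
    Rintegral leb `[s, t]%classic g = f t - f s.

Lemma sub_itv_J (s t : R) : 0 <= s -> t <= T -> `[s, t]%classic `<=` J.
Proof.
move=> s0 tT x /=; rewrite !in_itv /= => /andP[sx xt].
by rewrite (le_trans s0 sx) (le_trans xt tT).
Qed.

Lemma ip_indic g (s t : R) : 0 <= s -> t <= T ->
  ip g \1_(`[s, t]%classic) = Rintegral leb `[s, t]%classic g.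
Proof.
move=> s0 tT; rewrite -[in RHS](setIidr (sub_itv_J s0 tT)) Rintegral_mkcondr.
apply: eq_Rintegral => x _; rewrite patchE indicE; case: ifP => h.
  by rewrite mulr1.
by rewrite mulr0.
Qed.

Lemma sqint_indic (s t : R) : L2 \1_(`[s, t]%classic).
Proof.
apply: (@sqint_bounded _ _ _ leb J mJ fJ _ 1) => [|x _].
  exact: measurable_indic.
by rewrite indicE; case: (_ \in _); rewrite ?normr1 ?normr0.
Qed.

Lemma nrm2_indic (s t : R) : 0 <= s -> s <= t -> t <= T ->
  nrm2 \1_(`[s, t]%classic) = t - s.
Proof.
move=> s0 st tT; rewrite ip_indic//.
rewrite (@eq_Rintegral _ _ _ leb _ (cst 1)); last by move=> x xst; rewrite xst.
rewrite Rintegral_cst// mul1r.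
have len : fine (leb (`[s, t]%classic : set R)) = t - s.
  rewrite lebesgue_measure_itv /= lte_fin.
  by move: st; rewrite le_eqVlt => /predU1P[->|->//]; rewrite ltxx subrr.
exact: len.
Qed.

Lemma Rintegral_itv_sq g (s t : R) : L2 g -> 0 <= s -> s <= t -> t <= T ->
  (Rintegral leb `[s, t]%classic g) ^+ 2 <= nrm2 g * (t - s).
Proof.
move=> sg s0 st tT; rewrite -ip_indic// -nrm2_indic//.
exact: (ip_cauchy_schwarz mJ sg (sqint_indic s t)).
Qed.

Lemma L2_integrable g : L2 g -> leb.-integrable J (EFin \o g).
Proof. exact: (@sqint_integrable _ _ _ leb J mJ fJ). Qed.

Lemma L2_integrable_sub g (s t : R) : L2 g -> 0 <= s -> t <= T ->
  leb.-integrable `[s, t]%classic (EFin \o g).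
Proof.
move=> /L2_integrable ig s0 tT.
by apply: integrableS ig => //; exact: sub_itv_J.
Qed.

Lemma h1dD f g f' g' : h1d f f' -> h1d g g' ->
  h1d (fun t => f t + g t) (fun t => f' t + g' t).
Proof.
move=> [sf hf] [sg hg]; split; first exact: (sqintD mJ).
move=> s t s0 st tT; rewrite RintegralD//; [|exact: L2_integrable_sub..].
by rewrite hf// hg//; ring.
Qed.

Lemma h1dZ c f f' : h1d f f' -> h1d (fun t => c * f t) (fun t => c * f' t).
Proof.
move=> [sf hf]; split; first exact: (sqintZ mJ).
move=> s t s0 st tT; rewrite RintegralZl//; last exact: L2_integrable_sub.
by rewrite hf//; ring.
Qed.

Lemma h1dN f f' : h1d f f' -> h1d (fun t => - f t) (fun t => - f' t).
Proof.
move=> /(h1dZ (-1)); congr h1d; apply/funext => t; exact: mulN1r.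
Qed.

Lemma h1dB f g f' g' : h1d f f' -> h1d g g' ->
  h1d (fun t => f t - g t) (fun t => f' t - g' t).
Proof. by move=> hf hg; exact: h1dD hf (h1dN hg). Qed.

(** Hölder continuity with exponent 1/2, from Cauchy-Schwarz against an indicator. The constant
    depends only on the norm of the derivative: this is the equicontinuity behind Ascoli. *)
Lemma h1d_osc f g (s t : R) : h1d f g -> 0 <= s -> s <= t -> t <= T ->
  (f t - f s) ^+ 2 <= nrm2 g * (t - s).
Proof. by move=> [sg hg] s0 st tT; rewrite -hg//; exact: Rintegral_itv_sq. Qed.

Lemma h1d_cont f g : h1d f g -> {within `[0, T], continuous f}.
Proof.
move=> [sg hg].
have c1 : {within `[0, T], continuous (fun x => f 0 + \int[leb]_(t in `[0, x]) g t)}.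
  apply: within_continuousD; first by move=> x; exact: cvg_cst.
  by apply: parameterized_integral_continuous; [exact: ltW|exact: L2_integrable].
apply: subspace_eq_continuous c1 => t; rewrite inE /= in_itv /= => /andP[t0 tT].
by transitivity (f 0 + (f t - f 0)); [congr (_ + _); exact: hg|rewrite addrC subrK].
Qed.

Lemma cont_measurable_J (f : R -> R) : {within `[0, T], continuous f} ->
  measurable_fun J f.
Proof. by move=> cf; apply: subspace_continuous_measurable_fun. Qed.

Lemma cont_L2 (f : R -> R) : {within `[0, T], continuous f} -> L2 f.
Proof.
move=> cf.
have cf2 : {within `[0, T], continuous (fun x => f x ^+ 2)}.
  rewrite (_ : (fun x => f x ^+ 2) = (fun x => f x * f x)); last first.
    by apply/funext => x; rewrite expr2.
  by move=> x; apply: cvgM; exact: cf.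
split; first exact: cont_measurable_J.
exact: (continuous_compact_integrable (@segment_compact R 0 T) cf2).
Qed.

Lemma h1d_L2 f g : h1d f g -> L2 f.
Proof. by move=> /h1d_cont /cont_L2. Qed.

Lemma h1d_C1 (f f' : R -> R) : (forall x : R, is_derive x 1 f (f' x)) ->
  continuous f' -> h1d f f'.
Proof.
move=> df cf'; split; first exact/cont_L2/continuous_subspaceT.
move=> s t s0; rewrite le_eqVlt => /predU1P[->|st] tT.
  by rewrite set_itv1 Rintegral_set1 subrr.
have cf : continuous f.
  move=> x; have [dx _] := df x.
  by apply: differentiable_continuous; exact/derivable1_diffP.
rewrite /Rintegral (@continuous_FTC2 _ f' f)//=.
- exact: continuous_subspaceT.
- split; first by move=> x _; have [dx _] := df x.
    by apply: cvg_at_right_filter; exact: cf.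
  by apply: cvg_at_left_filter; exact: cf.
- by move=> x _; rewrite derive1E; have [_ ->] := df x.
Qed.

Lemma h1d_unique f g g' h : h1d f g -> h1d f g' -> L2 h -> ip g h = ip g' h.
Proof.
move=> [sg hg] [sg' hg'] sh; apply/eqP; rewrite -subr_eq0; apply/eqP.
rewrite -(ipBl mJ)//; apply: indic_total => //; first exact: (sqintB mJ).
move=> s t s0 st tT; rewrite RintegralB//; [|exact: L2_integrable_sub..].
by rewrite hg// hg'// subrr.
Qed.

(** Pairing [g n] with the indicator of [[s, t]] gives an increment of [f n], whose limit is known;
    these indicators are the total family for [weak_limit]. *)
Lemma h1d_weak_limit (f g : nat -> R -> R) (f0 : R -> R) (C : R) :
  (forall n, h1d (f n) (g n)) -> (forall n, nrm2 (g n) <= C) ->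
  (forall t, 0 <= t -> t <= T -> f n t @[n --> \oo] --> f0 t) ->
  exists g0, h1d f0 g0 /\
    forall h, L2 h -> ip (g n) h @[n --> \oo] --> ip g0 h.
Proof.
move=> fg gC ff0.
pose adm (h : R -> R) (z : R * R) :=
  [/\ 0 <= z.1, z.1 <= z.2, z.2 <= T & h = \1_(`[z.1, z.2]%classic)].
pose H : set (R -> R) := [set h | exists z, adm h z].
(* The limit must be a function of the test function, so an interval is chosen back from its
   indicator; the default matters only outside [H]. *)
pose L h := let z := xget (0, 0) (adm h) in f0 z.2 - f0 z.1.
have cvL n z : 0 <= z.1 -> z.1 <= z.2 -> z.2 <= T ->
    ip (g n) \1_(`[z.1, z.2]%classic) = f n z.2 - f n z.1.
  by move=> z0 z12 zT; rewrite ip_indic// (proj2 (fg n)).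
have cvH h : H h -> ip (g n) h @[n --> \oo] --> L h.
  move=> [z0 az0]; rewrite /L; case: xgetP => [z _ [z1 z12 zT ->]|/(_ z0)//].
  rewrite (_ : (fun n => _) = (fun n => f n z.2 - f n z.1)); last first.
    by apply/funext => n; exact: cvL.
  by apply: cvgB; apply: ff0 => //; [exact: le_trans z12|exact: le_trans zT].
have sH h : H h -> L2 h by move=> [z [_ _ _ ->]]; exact: sqint_indic.
have totH k : L2 k -> (forall h, H h -> ip k h = 0) -> forall h, L2 h -> ip k h = 0.
  move=> sk kH h sh; apply: indic_total => // s t s0 st tT.
  by rewrite -ip_indic//; apply: kH; exists (s, t).
have [g0 [sg0 cvg0]] := weak_limit mJ fJ (fun n => proj1 (fg n)) gC sH totH cvH.
exists g0; split => //; split => // s t s0 st tT.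
rewrite -ip_indic//.
have h1 := cvg0 _ (sqint_indic s t).
have h2 : ip (g n) \1_(`[s, t]%classic) @[n --> \oo] --> f0 t - f0 s.
  rewrite (_ : (fun n => _) = (fun n => f n t - f n s)); last first.
    by apply/funext => n; exact: (cvL n (s, t)).
  by apply: cvgB; apply: ff0 => //; [exact: le_trans st|exact: le_trans tT].
exact: (cvg_unique _ h1 h2).
Qed.

End H1Scalar.

(** * The a priori estimate in the rotating frame *)

Section Rotating.
Context (R : realType) (T : R).
Hypothesis T0 : 0 < T.
Local Notation leb := (@lebesgue_measure R).
Local Notation J := (`[0, T]%classic : set (measurableTypeR R)).
Local Notation L2 := (sqint leb J).
Local Notation ip := (ip leb J).
Local Notation nrm2 f := (ip f%R f%R).
Local Notation h1d := (h1d T).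
Local Notation int0 f t := (Rintegral leb `[0, t]%classic f).

Let mJ := @measurable_J R T.

Lemma norm_le_sqrt (a b : R) : a ^+ 2 <= b -> `|a| <= Num.sqrt b.
Proof.
move=> ab; rewrite -sqrtr_sqr ler_sqrt//.
by rewrite (le_trans _ ab)// sqr_ge0.
Qed.

Lemma is_derive_int0 (f : R -> R) (t : R) : {within `[0, T], continuous f} ->
  0 < t -> t < T -> is_derive t 1 (fun t => int0 f t) (f t).
Proof.
move=> cf t0 tT.
have tJ : t \in `]0, T[%R by rewrite in_itv /= t0.
have [dF dE] := continuous_FTC1_closed tT (L2_integrable T0 (cont_L2 cf))
  t0 (within_continuous_continuous T0 cf tJ).
by split=> //; rewrite -derive1E dE.
Qed.

Lemma is_derive_cos_mul (w t : R) :
  is_derive t 1 (fun t => cos (w * t)) (- (w * sin (w * t))).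
Proof.
have dw : is_derive t 1 (fun t => w * t) w.
  by apply: (is_derive_eq (is_deriveZ w (is_derive_id t (1 : R)))); rewrite [_ *: _]mulr1.
by apply: (is_derive_eq (is_derive1_comp (is_derive_cos (w * t)) dw)); rewrite mulrC mulrN.
Qed.

Lemma is_derive_sin_mul (w t : R) :
  is_derive t 1 (fun t => sin (w * t)) (w * cos (w * t)).
Proof.
have dw : is_derive t 1 (fun t => w * t) w.
  by apply: (is_derive_eq (is_deriveZ w (is_derive_id t (1 : R)))); rewrite [_ *: _]mulr1.
by apply: (is_derive_eq (is_derive1_comp (is_derive_sin (w * t)) dw)); rewrite mulrC.
Qed.

Lemma continuous_cos_mul (w : R) : continuous (fun t : R => cos (w * t)).
Proof.
move=> t; apply: differentiable_continuous; apply/derivable1_diffP.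
by have [] := is_derive_cos_mul w t.
Qed.

Lemma continuous_sin_mul (w : R) : continuous (fun t : R => sin (w * t)).
Proof.
move=> t; apply: differentiable_continuous; apply/derivable1_diffP.
by have [] := is_derive_sin_mul w t.
Qed.

(* With A, B the primitives of the two residuals, [x - A] and [y - B] are C^1,
   so that the rotated curve can be differentiated classically. *)
Lemma rotating_bound (w K : R) (x y x' y' : R -> R) :
  h1d x x' -> h1d y y' -> 0 <= w ->
  nrm2 (fun t => x' t - w * y t) <= K -> nrm2 (fun t => y' t + w * x t) <= K ->
  forall t, 0 <= t -> t <= T ->
  `|cos (w * t) * x t - sin (w * t) * y t - x 0|
     <= 2 * Num.sqrt (K * T) * (1 + w * T).
Proof.
move=> hx hy w0 Ka Kb t t0 tT.
have [sx' ix] := hx; have [sy' iy] := hy.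
have cx := h1d_cont T0 hx; have cy := h1d_cont T0 hy.
have sx := cont_L2 cx; have sy := cont_L2 cy.
pose a t := x' t - w * y t; pose b t := y' t + w * x t.
have sa : L2 a by apply: (sqintB mJ) => //; exact: (sqintZ mJ).
have sb : L2 b by apply: (sqintD mJ) => //; exact: (sqintZ mJ).
pose m := Num.sqrt (K * T).
have m0 : 0 <= m by exact: sqrtr_ge0.
have bnd (f : R -> R) s : L2 f -> nrm2 f <= K -> 0 <= s -> s <= T ->
    `|int0 f s| <= m.
  move=> sf fK s0 sT; apply: norm_le_sqrt.
  apply: le_trans (Rintegral_itv_sq T0 sf (lexx 0) s0 sT) _.
  by rewrite subr0 ler_pM// ip_ge0.
have ea s : 0 <= s -> s <= T -> x s - int0 a s = x 0 + w * int0 y s.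
  move=> s0 sT; rewrite /a RintegralB//; last 2 first.
  - exact: (L2_integrable_sub T0).
  - by apply: (L2_integrable_sub T0) => //; exact: (sqintZ mJ).
  rewrite RintegralZl//; last exact: (L2_integrable_sub T0).
  by rewrite ix//; ring.
have eb s : 0 <= s -> s <= T -> y s - int0 b s = y 0 - w * int0 x s.
  move=> s0 sT; rewrite /b RintegralD//; last 2 first.
  - exact: (L2_integrable_sub T0).
  - by apply: (L2_integrable_sub T0) => //; exact: (sqintZ mJ).
  rewrite RintegralZl//; last exact: (L2_integrable_sub T0).
  by rewrite iy//; ring.
(* By [ea] and [eb] these are [x - A] and [y - B], now expressed by primitives of continuous
   functions. *)
pose p1 s := x 0 + w * int0 y s; pose p2 s := y 0 - w * int0 x s.
(* The real part of [e^{iws} psi(s)], and below it the real part of [- i w e^{iws} G(s)]. The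
   imaginary part is covered by applying the lemma to [- i zeta]. *)
pose phi := (fun s => cos (w * s)) * p1 - (fun s => sin (w * s)) * p2 : R -> R.
pose dphi s := w * (sin (w * s) * int0 a s + cos (w * s) * int0 b s).
have dp1 s : 0 < s -> s < T -> is_derive s 1 p1 (w * y s).
  move=> s0 sT; have dy := is_derive_int0 cy s0 sT.
  apply: (is_derive_eq (is_deriveD (is_derive_cst (x 0) s 1) (is_deriveZ w dy))).
  by rewrite add0r.
have dp2 s : 0 < s -> s < T -> is_derive s 1 p2 (- (w * x s)).
  move=> s0 sT; have dx := is_derive_int0 cx s0 sT.
  apply: (is_derive_eq (is_deriveB (is_derive_cst (y 0) s 1) (is_deriveZ w dx))).
  by rewrite add0r.
have dphiP s : s \in `]0, t[%R -> is_derive s 1 phi (dphi s).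
  rewrite in_itv /= => /andP[s0 st].
  have sT : s < T := lt_le_trans st tT.
  apply: (is_derive_eq (is_deriveB (is_deriveM (is_derive_cos_mul w s) (dp1 s s0 sT))
    (is_deriveM (is_derive_sin_mul w s) (dp2 s s0 sT)))); rewrite /dphi.
  have := ea s (ltW s0) (ltW sT); have := eb s (ltW s0) (ltW sT).
  rewrite -/(p1 s) -/(p2 s) => <- <-.
  by rewrite -![_ *: _]/(_ * _); ring.
have cp (f : R -> R) c k : {within `[0, T], continuous f} ->
    {within `[0, t], continuous (fun s => c + k * int0 f s)}.
  move=> cf.
  have h : {within `[0, t], continuous (fun s => int0 f s)}.
    apply: parameterized_integral_continuous => //.
    by apply: (L2_integrable_sub T0) => //; exact: cont_L2.
  apply: within_continuousD; first by move=> z; exact: cvg_cst.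
  by move=> z; apply: cvgM; [exact: cvg_cst|exact: h].
have cphi : {within `[0, t], continuous phi}.
  have cc : {within `[0, t], continuous (fun s => cos (w * s))}.
    exact/continuous_subspaceT/continuous_cos_mul.
  have cs : {within `[0, t], continuous (fun s => sin (w * s))}.
    exact/continuous_subspaceT/continuous_sin_mul.
  apply: within_continuousB => z; apply: cvgM.
  - exact: cc.
  - exact: (cp y (x 0) w cy).
  - exact: cs.
  - rewrite (_ : p2 = fun s => y 0 + (- w) * int0 x s).
      exact: (cp x (y 0) (- w) cx).
    by apply/funext => s; rewrite /p2 mulNr.
have [c /[!in_itv] /= /andP[c0 ct] hc] := MVT_segment t0 dphiP cphi.
have cT := le_trans ct tT.
have phi0 : phi 0 = x 0.
  rewrite /phi -[LHS]/(cos (w * 0) * p1 0 - sin (w * 0) * p2 0) mulr0 cos0 sin0.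
  by rewrite /p1 set_itv1 Rintegral_set1; ring.
have phit : phi t = cos (w * t) * (x t - int0 a t) - sin (w * t) * (y t - int0 b t).
  by rewrite ea// eb.
have e1 : cos (w * t) * x t - sin (w * t) * y t - x 0 =
    dphi c * t + (cos (w * t) * int0 a t - sin (w * t) * int0 b t).
  move: hc; rewrite phi0 phit subr0 => <-; ring.
have tr (u v p q : R) : `|u| <= 1 -> `|v| <= 1 -> `|p| <= m -> `|q| <= m ->
    `|u * p + v * q| <= 2 * m.
  move=> u1 v1 pm qm; apply: le_trans (ler_normD _ _) _.
  rewrite !normrM (_ : 2 * m = 1 * m + 1 * m); last by ring.
  by apply: lerD; apply: ler_pM.
have cos1 z : `|cos z| <= 1 :> R by rewrite ler_norml cos_geN1 cos_le1.
have sin1 z : `|sin z| <= 1 :> R by rewrite ler_norml sin_geN1 sin_le1.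
have ba := bnd a; have bb := bnd b.
(* The final constant has two sources: [2 m w T] from the mean value theorem, and [2 m] from the
   term [e^{iwt} G(t)] separating [psi] from [zeta]. *)
have q1 : `|dphi c * t| <= 2 * m * (w * T).
  rewrite /dphi !normrM (ger0_norm w0) (ger0_norm t0).
  rewrite (_ : 2 * m * (w * T) = w * (2 * m) * T); last by ring.
  apply: ler_pM => //; first by rewrite mulr_ge0.
  by rewrite ler_wpM2l//; apply: tr => //; [exact: ba|exact: bb].
have q2 : `|cos (w * t) * int0 a t - sin (w * t) * int0 b t| <= 2 * m.
  rewrite -mulrN; apply: tr => //; first exact: ba.
  by rewrite normrN; exact: bb.
rewrite e1 -/m; apply: le_trans (ler_normD _ _) _; lra.
Qed.

End Rotating.

(** * Ultrafilter limits and Ascoli's theorem *)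

Section Compactness.
Context (R : realType).

Lemma ultra_bounded_cvg (G : set_system nat) (u : nat -> R) (M : R) :
  UltraFilter G -> (forall n, `|u n| <= M) -> exists l : R, u @ G --> l.
Proof.
move=> UG uM.
have PG : ProperFilter G by exact: ultra_proper.
have uG : (u @ G) `[- M, M]%classic.
  suff : G (u @^-1` `[- M, M]%classic) by [].
  by apply: filterS filterT => n _; rewrite /= in_itv /= -ler_norml.
have [l [_ lcl]] := @segment_compact R (- M) M (u @ G) _ uG.
exists l => A Al.
have [//|GA] := in_ultra_setVsetC (u @^-1` A) UG.
have [|z [zA zA']] := lcl (~` A) A _ Al; last by case: zA.
exact: GA.
Qed.

(** The ultrafilter gives limits at all times at once, without diagonal extraction. One index can
    then be picked that is good at all nodes of a finite grid, and equicontinuity covers the rest.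
    The limits along [G] are kept in the conclusion since they also hold outside [[0, T]], where
    they yield periodicity. *)
Lemma ascoli_subseq (I : finType) (T C M : R) (f : nat -> I -> R -> R) :
  0 < T -> 0 <= C ->
  (forall n a t, `|f n a t| <= M) ->
  (forall n a (s t : R), 0 <= s -> s <= t -> t <= T ->
     (f n a t - f n a s) ^+ 2 <= C * (t - s)) ->
  exists (G : set_system nat) (f0 : I -> R -> R) (phi : nat -> nat) (e : nat -> R),
    [/\ ProperFilter G, forall a t, f n a t @[n --> G] --> f0 a t,
        forall k, (k <= phi k)%N, e @ \oo --> 0
      & forall k a t, 0 <= t -> t <= T -> `|f (phi k) a t - f0 a t| <= e k].
Proof.
move=> T0 C0 fM fC.
have [G [UG ooG]] := ultraFilterLemma (@eventually_filter).
have PG : ProperFilter G by exact: ultra_proper.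
have ex (at_ : I * R) : exists l : R, f n at_.1 at_.2 @[n --> G] --> l.
  exact: (ultra_bounded_cvg UG (fun n => fM n at_.1 at_.2)).
have [f0' f0P'] := choice ex.
pose f0 a t := f0' (a, t).
have f0P a t : f n a t @[n --> G] --> f0 a t by exact: (f0P' (a, t)).
have nf0 a t d : 0 < d -> G [set n | `|f0 a t - f n a t| < d].
  by move=> d0; move/cvgrPdist_lt : (f0P a t) => /(_ d d0).
have f_osc n a (s t : R) : 0 <= s -> s <= t -> t <= T ->
    `|f n a t - f n a s| <= Num.sqrt (C * (t - s)).
  move=> s0 st tT; rewrite -sqrtr_sqr ler_sqrt ?fC//.
  by rewrite mulr_ge0// subr_ge0.
have f0_osc a (s t : R) : 0 <= s -> s <= t -> t <= T ->
    `|f0 a t - f0 a s| <= Num.sqrt (C * (t - s)).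
  move=> s0 st tT; apply/ler_addgt0Pr => d d0.
  have d2 : 0 < d / 2 by rewrite divr_gt0.
  have [n [n1 n2]] := filter_ex (filterI (nf0 a t _ d2) (nf0 a s _ d2)).
  have n3 := f_osc n a s t s0 st tT.
  rewrite (_ : f0 a t - f0 a s = (f0 a t - f n a t) + ((f n a t - f n a s)
     - (f0 a s - f n a s))); last by ring.
  apply: le_trans (ler_normD _ _) _.
  have := ler_normB (f n a t - f n a s) (f0 a s - f n a s).
  by move=> h; rewrite /= in n1 n2; lra.
(* With this step an oscillation [sqrt (C * del k)] is of order [1 / (k + 1)], like the error
   allowed at the nodes. *)
pose del k : R := T / (k.+1%:R ^+ 2).
have del0 k : 0 < del k by rewrite divr_gt0// exprn_gt0// ltr0n.
pose good k n := (k <= n)%N /\ forall (a : I) (j : 'I_(k.+1 ^ 2).+1),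
  `|f0 a (j%:R * del k) - f n a (j%:R * del k)| < k.+1%:R^-1.
have Ggood k : G (good k).
  apply: filterI; first by apply: ooG; exists k.
  apply: filter_forall => a; apply: filter_forall => j.
  by apply: nf0; rewrite invr_gt0 ltr0n.
have [phi phiP] := choice (fun k => filter_ex (Ggood k)).
(* One error at a node, and one oscillation each for [f (phi k)] and [f0]. *)
exists G, f0, phi, (fun k => (1 + 2 * Num.sqrt (C * T)) * k.+1%:R^-1).
split => //.
- by move=> k; case: (phiP k).
- rewrite -(mulr0 (1 + 2 * Num.sqrt (C * T))).
  by apply: cvgM; [exact: cvg_cst|exact: cvg_harmonic].
move=> k a t t0 tT.
have [_ nk] := phiP k.
pose j := Num.truncn (t / del k).
have td0 : 0 <= t / del k by rewrite divr_ge0// ltW.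
have /andP[j1 j2] := truncn_itv td0.
rewrite -/j in j1 j2.
have j1' : j%:R * del k <= t by rewrite -ler_pdivlMr.
have j2' : t - j%:R * del k <= del k.
  have : t <= j.+1%:R * del k by rewrite -ler_pdivrMr// ltW.
  by rewrite -natr1; lra.
have jlt : (j < (k.+1 ^ 2).+1)%N.
  rewrite ltnS -(ler_nat R) (le_trans j1)// natrX ler_pdivrMr//.
  by rewrite /del mulrC divfK// expf_neq0// pnatr_eq0.
have := nk a (Ordinal jlt); rewrite /=; set s := j%:R * del k => hj.
have s0 : 0 <= s by rewrite mulr_ge0// ltW.
have r1 := f_osc (phi k) a s t s0 j1' tT.
have r2 := f0_osc a s t s0 j1' tT.
have r3 : Num.sqrt (C * (t - s)) <= Num.sqrt (C * T) * k.+1%:R^-1.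
  have -> : Num.sqrt (C * T) * k.+1%:R^-1 = Num.sqrt (C * del k).
    rewrite /del mulrA (sqrtrM _ (mulr_ge0 C0 (ltW T0))); congr (_ * _).
    by rewrite -exprVn sqrtr_sqr ger0_norm// invr_ge0.
  by rewrite ler_sqrt; [rewrite ler_wpM2l|rewrite mulr_ge0// ltW].
rewrite (_ : f (phi k) a t - f0 a t = (f (phi k) a t - f (phi k) a s)
  - ((f0 a t - f0 a s) + (f0 a s - f (phi k) a s))); last by ring.
apply: le_trans (ler_normB _ _) _.
have := ler_normD (f0 a t - f0 a s) (f0 a s - f (phi k) a s).
move=> h; rewrite mulrDl mul1r -[2 * _ * _]mulrA.
move: (_^-1) (_ * _^-1) (Num.sqrt (C * (t - s))) hj r1 r2 r3 h => u v z.
lra.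
Qed.

End Compactness.

(** * Paths, the kinetic term and the potential *)

Section Paths.
Context (R : realType) (N : nat).
Local Notation T := (T2pi R).
Local Notation mu := (@leb R).
Local Notation I := (@I0 R).
Local Notation L2 := (sqint mu I).
Local Notation ip := (ip mu I).
Local Notation nrm2 f := (ip f%R f%R).
Local Notation h1d := (h1d T).
Local Notation path := (Defs.path R N).
Implicit Types (q v : path) (w : R).

Lemma T2pi_gt0 : 0 < T. Proof. by rewrite /T2pi mulr_gt0// pi_gt0. Qed.
Let T0 := T2pi_gt0.
Let mI : @measurable _ (measurableTypeR R) I := @measurable_J R T.

Definition component q (i : 'I_N) (k : 'I_3) : R -> R := fun t => q t i k.

Lemma H1_derivP q v :
  is_H1_deriv q v <-> forall i k, h1d (component q i k) (component v i k).
Proof.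
split=> [h i k|h i k].
  have [mv [iv [iv2 hv]]] := h i k; split; first by split.
  by move=> s t s0 st tT; rewrite /Rintegral hv.
have [sv hv] := h i k; have iv := L2_integrable T0 sv.
split; first by case: sv.
split; first exact: iv.
split; first by case: sv.
move=> s t s0 st tT; rewrite -[RHS]/((component q i k t - component q i k s)%:E) -hv//.
rewrite /Rintegral fineK//; apply: integrable_fin_num => //.
exact: (L2_integrable_sub T0 sv).
Qed.

(** The components of [zeta' + i w zeta] and [z']. They are linear in [(q, v)], so weak limits pass
    through them, and the kinetic integrand is the sum of their squares. *)
Definition res w q v (i : 'I_N) (k : 'I_3) (t : R) : R :=
  if k == cx then v t i cx - w * q t i cy
  else if k == cy then v t i cy + w * q t i cx else v t i k.

Lemma sum3 (V : nmodType) (F : 'I_3 -> V) :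
  \sum_(k < 3) F k = F cx + F cy + F cz.
Proof.
rewrite !big_ord_recl big_ord0 addr0 addrA.
by congr (F _ + F _ + F _); exact: val_inj.
Qed.

Lemma kin_res w q v t :
  kin w (q t) (v t) = \sum_(i < N) \sum_(k < 3) res w q v i k t ^+ 2.
Proof. by apply: eq_bigr => i _; rewrite sum3. Qed.

Lemma H1_L2 q v i k : is_H1_deriv q v -> L2 (component q i k).
Proof. by move=> /H1_derivP h; exact: (h1d_L2 T0 (h i k)). Qed.

Lemma H1_L2d q v i k : is_H1_deriv q v -> L2 (component v i k).
Proof. by move=> /H1_derivP h; case: (h i k). Qed.

Lemma res_L2 w q v i k : is_H1_deriv q v -> L2 (res w q v i k).
Proof.
move=> h; rewrite /res; case: (k == cx).
  have h1 : L2 (component v i cx) by exact: H1_L2d h.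
  have h2 : L2 (component q i cy) by exact: H1_L2 h.
  exact: (@sqintB _ _ _ mu _ mI _ _ h1 (sqintZ mI w h2)).
case: (k == cy); last exact: H1_L2d h.
have h1 : L2 (component v i cy) by exact: H1_L2d h.
have h2 : L2 (component q i cx) by exact: H1_L2 h.
exact: (@sqintD _ _ _ mu _ mI _ _ h1 (sqintZ mI w h2)).
Qed.

Definition kinetic w q v : R :=
  2^-1 * \sum_(i < N) \sum_(k < 3) nrm2 (res w q v i k).

Lemma integrable_sumR (J : finType) (f : J -> R -> R) :
  (forall j, mu.-integrable I (EFin \o f j)) ->
  mu.-integrable I (EFin \o (fun t => \sum_j f j t)).
Proof.
move=> fi.
have := integrable_sum mI (index_enum J) (P := xpredT) (fun j _ => fi j).
by congr (integrable _ _ _); apply/funext => t /=; rewrite sumEFin.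
Qed.

Lemma integral_sumR (J : finType) (f : J -> R -> R) :
  (forall j, mu.-integrable I (EFin \o f j)) ->
  (\int[mu]_(t in I) (\sum_j f j t)%:E =
     (\sum_j Rintegral mu I (f j))%:E)%E.
Proof.
move=> fi; rewrite /Rintegral EFin_sum_fine; last first.
  by move=> j _; exact: (integrable_fin_num mI (fi j)).
transitivity (\int[mu]_(t in I) (\sum_j (f j t)%:E))%E.
  by apply: eq_integral => t _; rewrite sumEFin.
by apply: integral_sum => // j; exact: fi.
Qed.

Lemma integrable_half_kin w q v : is_H1_deriv q v ->
  mu.-integrable I (fun t => (2^-1 * kin w (q t) (v t))%:E).
Proof.
move=> h; apply: (integrableZl mI 2^-1 (f := EFin \o (fun t => kin w (q t) (v t)))).
rewrite (_ : (fun t => _) = (fun t => \sum_(i < N) \sum_(k < 3) res w q v i k t ^+ 2)).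
  apply: integrable_sumR => i; apply: integrable_sumR => k.
  by case: (res_L2 w i k h).
by apply/funext => t; exact: kin_res.
Qed.

Lemma integral_half_kin w q v : is_H1_deriv q v ->
  (\int[mu]_(t in I) (2^-1 * kin w (q t) (v t))%:E = (kinetic w q v)%:E)%E.
Proof.
move=> h; have ik i k : mu.-integrable I (EFin \o (fun t => res w q v i k t ^+ 2)).
  by case: (res_L2 w i k h).
have is_ i : mu.-integrable I
    (EFin \o (fun t => \sum_(k < 3) res w q v i k t ^+ 2)).
  exact: integrable_sumR.
transitivity (\int[mu]_(t in I) ((2^-1)%:E *
    (\sum_(i < N) \sum_(k < 3) res w q v i k t ^+ 2)%:E))%E.
  by apply: eq_integral => t _; rewrite -EFinM kin_res.
rewrite integralZl//; last exact: integrable_sumR.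
rewrite integral_sumR// -EFinM; congr (_ * _)%:E; apply: eq_bigr => i _.
by rewrite {1}/Rintegral integral_sumR//=; exact: eq_bigr.
Qed.

Definition invd (r : R) : \bar R := if r == 0 then +oo%E else (r^-1)%:E.

Lemma dist_ge0 (c : config R N) i j : 0 <= dist c i j.
Proof. exact: sqrtr_ge0. Qed.

Lemma invd_ge0 r : 0 <= r -> (0 <= invd r)%E.
Proof. by move=> r0; rewrite /invd; case: ifP => // _; rewrite lee_fin invr_ge0. Qed.

Lemma UpotE (c : config R N) : Upot c =
  (\sum_(i < N) \sum_(j < N | (i < j)%N) invd (dist c i j))%E.
Proof. by []. Qed.

Lemma Upot_ge0 (c : config R N) : (0 <= Upot c)%E.
Proof.
by apply: sume_ge0 => i _; apply: sume_ge0 => j _; apply/invd_ge0/dist_ge0.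
Qed.

Lemma dist_cvg (c : nat -> config R N) (c0 : config R N) i j :
  (forall i k, c n i k @[n --> \oo] --> c0 i k) ->
  dist (c n) i j @[n --> \oo] --> dist c0 i j.
Proof.
move=> cc; rewrite /dist.
apply: continuous_cvg; first exact: sqrt_continuous.
rewrite sum3; under eq_fun do rewrite sum3.
have h k : (c n i k - c n j k) ^+ 2 @[n --> \oo] --> (c0 i k - c0 j k) ^+ 2.
  have h : c n i k - c n j k @[n --> \oo] --> c0 i k - c0 j k by apply: cvgB.
  by rewrite expr2; under eq_fun do rewrite expr2; exact: cvgM.
by apply: cvgD; [apply: cvgD|].
Qed.

(** On nonnegative numbers the reciprocal is continuous up to 0 with value [+oo], so collisions of a
    limit loop need no separate treatment. *)
Lemma invd_cvg (r : nat -> R) (r0 : R) : (forall n, 0 <= r n) -> 0 <= r0 ->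
  r @ \oo --> r0 -> invd (r n) @[n --> \oo] --> invd r0.
Proof.
move=> rn0 r00 rr; rewrite {2}/invd; case: ifPn => [/eqP r0E|r0N].
  apply/cvgeyPge => A; have [A0|A0] := leP A 0.
    by apply: nearW => n; apply: (@le_trans _ _ 0%E); [rewrite lee_fin|exact: invd_ge0].
  move/cvgrPdist_lt : rr => /(_ A^-1); rewrite invr_gt0 => /(_ A0).
  apply: filterS => n; rewrite r0E sub0r normrN ger0_norm// => rA.
  rewrite /invd; case: ifPn => [_|rn]; first exact: leey.
  have rp : 0 < r n by rewrite lt_neqAle eq_sym rn rn0.
  by rewrite lee_fin -[A]invrK lef_pV2 ?posrE ?invr_gt0// ltW.
have rp : 0 < r0 by rewrite lt_neqAle eq_sym r0N.
have h : ((r n)^-1)%:E @[n --> \oo] --> (r0^-1)%:E.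
  by apply: cvg_EFin; [exact: nearW|exact: cvgV].
apply: cvg_trans h; apply: near_eq_cvg.
move/cvgrPdist_lt : rr => /(_ r0 rp); apply: filterS => n.
rewrite /invd; case: ifP => // /eqP ->; rewrite subr0 ger0_norm// ltxx; exact.
Qed.

Lemma cvg_sume_ge0 (J : Type) (s : seq J) (P : pred J) (F : J -> nat -> \bar R)
    (F0 : J -> \bar R) :
  (forall j n, (0 <= F j n)%E) -> (forall j, (0 <= F0 j)%E) ->
  (forall j, P j -> F j n @[n --> \oo] --> F0 j) ->
  (\sum_(j <- s | P j) F j n)%E @[n --> \oo] --> (\sum_(j <- s | P j) F0 j)%E.
Proof.
move=> F_ge0 F0_ge0 FF; elim: s => [|j s ih].
  by under eq_fun do rewrite big_nil; rewrite big_nil; exact: cvg_cst.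
under eq_fun do rewrite big_cons; rewrite big_cons; case: ifP => // Pj.
apply: cvgeD => //; last exact: FF.
by apply: ge0_adde_def; rewrite inE// sume_ge0.
Qed.

Lemma Upot_cvg (c : nat -> config R N) (c0 : config R N) :
  (forall i k, c n i k @[n --> \oo] --> c0 i k) ->
  Upot (c n) @[n --> \oo] --> Upot c0.
Proof.
move=> cc; rewrite UpotE; under eq_fun do rewrite UpotE.
have d0 c1 i j : (0 <= invd (@dist R N c1 i j))%E by exact/invd_ge0/dist_ge0.
apply: cvg_sume_ge0 => [i n|i|i _]; [exact: sume_ge0..|].
apply: cvg_sume_ge0 => // j _; apply: invd_cvg; [move=> n; exact: dist_ge0|exact: dist_ge0|].
exact: dist_cvg.
Qed.

Lemma measurable_invd_sqrt (f : R -> R) : measurable_fun I f ->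
  measurable_fun I (fun t => invd (Num.sqrt (f t))).
Proof.
move=> mf.
have -> : (fun t => invd (Num.sqrt (f t))) =
    (fun r : R => if r == 0 then +oo%E else (r `^ (-1))%:E) \o (Num.sqrt \o f).
  apply/funext => t; rewrite /invd /=; case: ifP => // _.
  by rewrite powR_inv1// sqrtr_ge0.
apply: measurableT_comp; last first.
  exact: measurableT_comp (continuous_measurable_fun (@sqrt_continuous R)) mf.
apply: measurable_fun_ifT => //; first exact: measurable_fun_eqr.
by apply/measurable_EFinP; exact: measurable_powR.
Qed.

Lemma measurable_Upot q v : is_H1_deriv q v ->
  measurable_fun I (fun t => Upot (q t)).
Proof.
move=> h; apply: emeasurable_sum => i.
rewrite (_ : (fun t => _) = (fun t => \sum_(j <- index_enum 'I_N)
    (if (i < j)%N then invd (dist (q t) i j) else 0))%E); last first.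
  by apply/funext => t; rewrite big_mkcond.
apply: emeasurable_sum => j; case: (i < j)%N => //.
apply: measurable_invd_sqrt.
rewrite (_ : (fun t => _) = (fun t => (q t i cx - q t j cx) ^+ 2 +
  (q t i cy - q t j cy) ^+ 2 + (q t i cz - q t j cz) ^+ 2)); last first.
  by apply/funext => t; rewrite sum3.
have m k : measurable_fun I (fun t => (q t i k - q t j k) ^+ 2).
  apply: measurable_funX; apply: measurable_funB.
    by case: (H1_L2 i k h).
  by case: (H1_L2 j k h).
by apply: measurable_funD => //; apply: measurable_funD.
Qed.

Lemma action_split w q v : is_H1_deriv q v ->
  (action w q v = (kinetic w q v)%:E + \int[mu]_(t in I) Upot (q t))%E.
Proof.
move=> h; rewrite /action ge0_integralD//.
- by rewrite integral_half_kin.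
- move=> t _; rewrite lee_fin mulr_ge0// kin_res.
  by apply: sumr_ge0 => i _; apply: sumr_ge0 => k _; exact: sqr_ge0.
- by case/integrableP : (integrable_half_kin w h).
- by move=> t _; exact: Upot_ge0.
- exact: measurable_Upot h.
Qed.

End Paths.

(** * Semicontinuity, compactness and the direct method *)

Section DirectMethod.
Context (R : realType) (N : nat).
Local Notation T := (T2pi R).
Local Notation mu := (@leb R).
Local Notation I := (@I0 R).
Local Notation L2 := (sqint mu I).
Local Notation ip := (ip mu I).
Local Notation nrm2 f := (ip f%R f%R).
Local Notation h1d := (h1d T).
Local Notation path := (Defs.path R N).
Implicit Types (q v : path) (w : R).

Let T0 := T2pi_gt0 R.
Let mI : @measurable _ (measurableTypeR R) I := @measurable_J R T.
Let fI : (mu I < +oo)%E := finite_J T0.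

Lemma Rintegral_cst_I0 (c : R) : Rintegral mu I (cst c) = c * T.
Proof.
rewrite Rintegral_cst//; congr (_ * _).
have len : fine (lebesgue_measure (`[0, T]%classic : set R)) = T.
  by rewrite lebesgue_measure_itv /= lte_fin T0 /= subr0.
by rewrite -[RHS]len.
Qed.

Lemma nrm2_le_bound (f : R -> R) (M : R) : L2 f ->
  (forall t, 0 <= t -> t <= T -> `|f t| <= M) -> nrm2 f <= M ^+ 2 * T.
Proof.
move=> sf fM.
have -> : M ^+ 2 * T = Rintegral mu I (cst (M ^+ 2)).
  by rewrite Rintegral_cst_I0.
apply: le_Rintegral => //; first exact: (sqintM mI).
  exact: (integrable_cst_fin mI fI).
move=> t; rewrite /I0 /= in_itv /= => /andP[t0 tT].
have ft := fM t t0 tT; have f0 := normr_ge0 (f t).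
by rewrite -expr2 -[f t ^+ 2]real_normK ?num_real// ler_sqr ?nnegrE// (le_trans f0).
Qed.

Lemma unif_weak_cvg (f : nat -> R -> R) (f0 h : R -> R) (e : nat -> R) :
  (forall n, L2 (f n)) -> L2 f0 -> L2 h -> e @ \oo --> 0 ->
  (forall n t, 0 <= t -> t <= T -> `|f n t - f0 t| <= e n) ->
  ip (f n) h @[n --> \oo] --> ip f0 h.
Proof.
move=> sf sf0 sh e0 fe.
have key n : `|ip f0 h - ip (f n) h| <= e n * Num.sqrt (T * nrm2 h).
  have sd : L2 (fun t => f n t - f0 t) by exact: (sqintB mI).
  have en0 : 0 <= e n by exact: le_trans (fe n 0 (lexx 0) (ltW T0)).
  have -> : e n * Num.sqrt (T * nrm2 h) = Num.sqrt (e n ^+ 2 * (T * nrm2 h)).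
    by rewrite (sqrtrM _ (sqr_ge0 (e n))) sqrtr_sqr ger0_norm.
  rewrite distrC -(ipBl mI)//.
  apply: norm_le_sqrt; apply: le_trans (ip_cauchy_schwarz mI sd sh) _.
  rewrite mulrA ler_wpM2r ?ip_ge0//; apply: nrm2_le_bound => // t t0 tT.
  exact: fe.
have lim0 : e n * Num.sqrt (T * nrm2 h) @[n --> \oo] --> (0 : R).
  by rewrite -(mul0r (Num.sqrt (T * nrm2 h))); apply: cvgM => //; exact: cvg_cst.
apply/cvgrPdist_lt => d d0.
move/cvgrPdist_lt : lim0 => /(_ d d0); apply: filterS => n.
rewrite sub0r normrN => h1; apply: le_lt_trans (key n) _.
by apply: le_lt_trans h1; exact: ler_norm.
Qed.

(** Uniform convergence of the positions makes them converge both pointwise, for the potential and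
    the symmetries, and weakly in L^2, for the residuals and the means. *)
Definition uw_cvg (qn vn : nat -> path) q v : Prop :=
  [/\ forall n, is_H1_deriv (qn n) (vn n), is_H1_deriv q v,
      exists e : nat -> R, e @ \oo --> 0 /\
        forall n t i k, `|qn n t i k - q t i k| <= e n
    & forall i k h, L2 h ->
        ip (component (vn n) i k) h @[n --> \oo] --> ip (component v i k) h].

Lemma uw_pointwise qn vn q v : uw_cvg qn vn q v ->
  forall t i k, qn n t i k @[n --> \oo] --> q t i k.
Proof.
move=> [_ _ [e [e0 qe]] _] t i k; apply/cvgrPdist_lt => d d0.
move/cvgrPdist_lt : e0 => /(_ d d0); apply: filterS => n.
rewrite sub0r normrN => h1; rewrite distrC; apply: le_lt_trans (qe n t i k) _.
by apply: le_lt_trans h1; exact: ler_norm.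
Qed.

Lemma uw_weak0 qn vn q v i k h : uw_cvg qn vn q v -> L2 h ->
  ip (component (qn n) i k) h @[n --> \oo] --> ip (component q i k) h.
Proof.
move=> [dqn dq [e [e0 qe]] _] sh; apply: (@unif_weak_cvg _ _ _ e) => //.
- by move=> n; exact: H1_L2 (dqn n).
- exact: H1_L2 dq.
- by move=> n t _ _; exact: qe.
Qed.

Lemma uw_res w qn vn q v i k h : uw_cvg qn vn q v -> L2 h ->
  ip (res w (qn n) (vn n) i k) h @[n --> \oo] --> ip (res w q v i k) h.
Proof.
move=> uw sh; have [dqn dq _ wv] := uw.
have sv n j l : L2 (component (vn n) j l) by exact: H1_L2d (dqn n).
have sq n j l : L2 (component (qn n) j l) by exact: H1_L2 (dqn n).
have sv0 j l : L2 (component v j l) by exact: H1_L2d dq.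
have sq0 j l : L2 (component q j l) by exact: H1_L2 dq.
rewrite /res; case: (k == cx).
  rewrite (ipBl mI (sv0 i cx) (sqintZ mI w (sq0 i cy)) sh) (ipZl mI w (sq0 i cy) sh).
  under eq_fun => n do
    rewrite (ipBl mI (sv n i cx) (sqintZ mI w (sq n i cy)) sh) (ipZl mI w (sq n i cy) sh).
  apply: cvgB; first exact: wv.
  by apply: cvgM; [exact: cvg_cst|exact: uw_weak0 uw sh].
case: (k == cy); last exact: wv.
rewrite (ipDl mI (sv0 i cy) (sqintZ mI w (sq0 i cx)) sh) (ipZl mI w (sq0 i cx) sh).
under eq_fun => n do
  rewrite (ipDl mI (sv n i cy) (sqintZ mI w (sq n i cx)) sh) (ipZl mI w (sq n i cx) sh).
apply: cvgD; first exact: wv.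
by apply: cvgM; [exact: cvg_cst|exact: uw_weak0 uw sh].
Qed.

Lemma cvg_sumR (J : Type) (s : seq J) (F : J -> nat -> R) (F0 : J -> R) :
  (forall j, F j n @[n --> \oo] --> F0 j) ->
  \sum_(j <- s) F j n @[n --> \oo] --> \sum_(j <- s) F0 j.
Proof.
move=> FF; elim: s => [|j s ih].
  by under eq_fun do rewrite big_nil; rewrite big_nil; exact: cvg_cst.
by under eq_fun do rewrite big_cons; rewrite big_cons; exact: cvgD.
Qed.

(** The kinetic part is at least its tangent [lin n] at the limit, and [lin n] tends to the kinetic
    part of the limit. Subtracting it from the bound leaves the potential alone, to which Fatou
    applies with the bounds [c n - lin n]. *)
Lemma uw_action_le w qn vn q v (c : nat -> R) (l : R) :
  uw_cvg qn vn q v -> (forall n, (action w (qn n) (vn n) <= (c n)%:E)%E) ->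
  c @ \oo --> l -> (action w q v <= l%:E)%E.
Proof.
move=> uw ac cl; have [dqn dq _ _] := uw.
pose F i k n := ip (res w (qn n) (vn n) i k) (res w q v i k) - nrm2 (res w q v i k).
pose lin n := kinetic w q v + \sum_(i < N) \sum_(k < 3) F i k n.
have F0 i k : F i k n @[n --> \oo] --> (0 : R).
  rewrite -(subrr (nrm2 (res w q v i k))).
  by apply: cvgB; [apply: uw_res uw _; exact: res_L2|exact: cvg_cst].
have linlim : lin n @[n --> \oo] --> kinetic w q v.
  have h := @cvg_sumR _ (index_enum 'I_N) (fun i n => \sum_(k < 3) F i k n)
    (fun=> \sum_(k < 3) (0 : R)) (fun i => @cvg_sumR _ _ (F i) (fun=> 0) (F0 i)).
  move: h; rewrite big1; last by move=> i _; rewrite big1.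
  by move=> h; rewrite -[X in _ --> X]addr0; apply: cvgD => //; exact: cvg_cst.
have kin_ge n : lin n <= kinetic w (qn n) (vn n).
  rewrite /lin /kinetic mulr_sumr mulr_sumr -big_split /=.
  apply: ler_sum => i _; rewrite !mulr_sumr -big_split /=.
  apply: ler_sum => k _.
  have := nrm2_lsc mI (res_L2 w i k dq) (res_L2 w i k (dqn n)); rewrite /F; lra.
rewrite action_split// -leeBrDl// -EFinB.
apply: (@integral_le_ae_cvg _ _ _ mu I mI (fun n t => Upot (qn n t)) _
  (fun n => c n - lin n)).
- by move=> n; exact: measurable_Upot (dqn n).
- by move=> n t _; exact: Upot_ge0.
- exact: measurable_Upot dq.
- apply: aeW => t _; apply: Upot_cvg => i k; exact: uw_pointwise uw t i k.
- exact: cvgB.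
- apply: nearW => n; rewrite EFinB leeBrDl//.
  apply: le_trans (ac n); rewrite action_split//.
  by apply: leeD => //; rewrite lee_fin.
Qed.

Lemma periodic_reduce (V : Type) (f : R -> V) (t : R) :
  (forall s, f (s + T) = f s) -> exists s, [/\ 0 <= s, s <= T & f t = f s].
Proof.
move=> fT.
have fn n s : f (s + n%:R * T) = f s.
  elim: n s => [|n ih] s; first by rewrite mul0r addr0.
  by rewrite -natr1 mulrDl mul1r addrA fT.
have [t0|t0] := leP 0 t.
  have /andP[h1 h2] := truncn_itv (divr_ge0 t0 (ltW T0)).
  move: h1 h2; set n := Num.truncn _; rewrite ler_pdivlMr// ltr_pdivrMr// => h1 h2.
  exists (t - n%:R * T); split; first by rewrite subr_ge0.
    by move: h2; rewrite -natr1 mulrDl mul1r; lra.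
  by rewrite -[in LHS](subrK (n%:R * T) t) fn.
have Nt0 : 0 <= - t by rewrite oppr_ge0 ltW.
have /andP[h1 h2] := truncn_itv (divr_ge0 Nt0 (ltW T0)).
move: h1 h2; set n := Num.truncn _; rewrite ler_pdivlMr// ltr_pdivrMr// => h1 h2.
exists (t + n.+1%:R * T); split; first lra.
  by rewrite -natr1 mulrDl mul1r; lra.
by rewrite fn.
Qed.

Lemma uw_compact (qn vn : nat -> path) (M C : R) :
  (forall n, is_H1_deriv (qn n) (vn n)) ->
  (forall n t, qn n (t + T) = qn n t) ->
  (forall n t i k, `|qn n t i k| <= M) ->
  (forall n i k, nrm2 (component (vn n) i k) <= C) ->
  exists phi q v, (forall k, (k <= phi k)%N) /\
    uw_cvg (fun n => qn (phi n)) (fun n => vn (phi n)) q v.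
Proof.
move=> dqn perq qM vC.
have C' : 0 <= Num.max C 0 by rewrite le_max lexx orbT.
have osc n (a : 'I_N * 'I_3) (s t : R) : 0 <= s -> s <= t -> t <= T ->
    (qn n t a.1 a.2 - qn n s a.1 a.2) ^+ 2 <= Num.max C 0 * (t - s).
  move=> s0 st tT; have /H1_derivP h := dqn n.
  apply: le_trans (h1d_osc T0 (h a.1 a.2) s0 st tT) _.
  by rewrite ler_wpM2r ?subr_ge0// le_max vC.
have [G [f0 [phi [e [PG f0G phik e0 fe]]]]] :=
  ascoli_subseq T0 C' (fun n (a : 'I_N * 'I_3) t => qM n t a.1 a.2) osc.
pose q : path := fun t i k => f0 (i, k) t.
have perq0 t : q (t + T) = q t.
  apply/funext => i; apply/funext => k.
  have := f0G (i, k) t; have := f0G (i, k) (t + T).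
  rewrite /= (_ : (fun n => qn n (t + T) i k) = (fun n => qn n t i k)); last first.
    by apply/funext => n; rewrite perq.
  by move=> h1 h2; exact: (cvg_unique _ h1 h2).
have fe' n t i k : `|qn (phi n) t i k - q t i k| <= e n.
  pose g t := `|qn (phi n) t i k - q t i k|.
  have gT s : g (s + T) = g s by rewrite /g perq perq0.
  have [s [s0 sT gs]] := periodic_reduce t gT; rewrite -/(g t) gs.
  exact: (fe n (i, k) s s0 sT).
(* No second extraction: convergence of the positions already determines the weak limits of the
   bounded velocities. *)
have ex (a : 'I_N * 'I_3) : exists g0, h1d (component q a.1 a.2) g0 /\
    forall h, L2 h -> ip (component (vn (phi n)) a.1 a.2) h @[n --> \oo] --> ip g0 h.
  apply: (@h1d_weak_limit R T T0 (fun n => component (qn (phi n)) a.1 a.2)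
    (fun n => component (vn (phi n)) a.1 a.2) (component q a.1 a.2) C).
  - by move=> n; have /H1_derivP := dqn (phi n).
  - by move=> n; exact: vC.
  - move=> t _ _; apply/cvgrPdist_lt => d d0.
    move/cvgrPdist_lt : (e0) => /(_ d d0); apply: filterS => n.
    rewrite sub0r normrN => h1; rewrite distrC; apply: le_lt_trans (fe' n t a.1 a.2) _.
    by apply: le_lt_trans h1; exact: ler_norm.
have [g gP] := choice ex.
exists phi, q, (fun t i k => g (i, k) t); split => //; split => //.
- apply/H1_derivP => i k; exact: (gP (i, k)).1.
- by exists e.
- move=> i k h sh; exact: ((gP (i, k)).2 h sh).
Qed.

Lemma kinetic_le_action w q v (C : R) : is_H1_deriv q v ->
  (action w q v <= C%:E)%E -> kinetic w q v <= C.
Proof.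
move=> h; rewrite action_split// => le; rewrite -lee_fin; apply: le_trans le.
by rewrite leeDl// integral_ge0// => t _; exact: Upot_ge0.
Qed.

Lemma res_le_action w q v (C : R) i k : is_H1_deriv q v ->
  (action w q v <= C%:E)%E -> nrm2 (res w q v i k) <= 2 * C.
Proof.
move=> h /(kinetic_le_action h); rewrite /kinetic => le.
apply: (@le_trans _ _ (\sum_(i < N) \sum_(k < 3) nrm2 (res w q v i k))); last lra.
rewrite (bigD1 i)//= (bigD1 k)//= -addrA lerDl addr_ge0//.
  by apply: sumr_ge0 => j _; exact: ip_ge0.
by apply: sumr_ge0 => j _; apply: sumr_ge0 => l _; exact: ip_ge0.
Qed.

Lemma nrm2D_le (f g : R -> R) : L2 f -> L2 g ->
  nrm2 (fun t => f t + g t) <= 2 * nrm2 f + 2 * nrm2 g.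
Proof.
move=> sf sg; have := ip_ge0 mu I (fun t => f t - g t).
by rewrite ipBB// ipDD//; lra.
Qed.

(** A planar velocity is its residual plus or minus [w] times the other planar coordinate, and
    [|a + b|^2 <= 2 |a|^2 + 2 |b|^2] is applied with the residual bound [2 * C]. *)
Lemma vel_bound w q v (C M : R) i k : is_H1_deriv q v -> 
  (action w q v <= C%:E)%E -> (forall t i k, `|q t i k| <= M) ->
  nrm2 (component v i k) <= 4 * C + 2 * (w ^+ 2 * (M ^+ 2 * T)).
Proof.
move=> h ac qM.
have rC := res_le_action i k h ac.
have sr := res_L2 w i k h.
have sq j l : L2 (component q j l) by exact: H1_L2 h.
have qb j l : nrm2 (component q j l) <= M ^+ 2 * T by apply: nrm2_le_bound => // t _ _; exact: qM.
have shift (c : R) j l : c ^+ 2 = w ^+ 2 ->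
    component v i k = (fun t => res w q v i k t + c * q t j l) ->
    nrm2 (component v i k) <= 4 * C + 2 * (w ^+ 2 * (M ^+ 2 * T)).
  move=> cw ->; have sz := sqintZ mI c (sq j l).
  apply: le_trans (nrm2D_le sr sz) _.
  have e : nrm2 (fun t => c * q t j l) = w ^+ 2 * nrm2 (component q j l).
    rewrite -cw expr2 -mulrA -(ipZl mI c (sq j l) (sq j l)) ipC.
    exact: (ipZl mI c (sq j l) sz).
  rewrite e.
  have := ler_wpM2l (sqr_ge0 w) (qb j l); lra.
have [kx|kx] := eqVneq k cx.
  apply: (shift w i cy) => //; apply/funext => t.
  by rewrite /res kx eqxx /component subrK.
have [ky|ky] := eqVneq k cy.
  apply: (shift (- w) i cx); first by rewrite sqrrN.
  by apply/funext => t; rewrite /res ky /component /= mulNr addrK.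
have -> : component v i k = res w q v i k.
  by apply/funext => t; rewrite /res (negbTE kx) (negbTE ky).
have n0 : 0 <= nrm2 (res w q v i k) by exact: ip_ge0.
have : 0 <= w ^+ 2 * (M ^+ 2 * T).
  by rewrite mulr_ge0 ?sqr_ge0// mulr_ge0 ?sqr_ge0// ltW.
move: (ip _ _) (w ^+ 2 * _) n0 rC => X Y; clear; lra.
Qed.

(* The bound [M] is only required after replacing a loop by a competitor of no
   larger action: at [w = N] the action has a noncompact symmetry. *)
Lemma direct_method w (S : set path) :
  S !=set0 -> (forall q, S q -> in_Lambda q) ->
  (forall C : R, exists M : R, forall q v, S q -> is_H1_deriv q v ->
     (action w q v <= C%:E)%E ->
     exists q' v', [/\ S q', is_H1_deriv q' v',
       (action w q' v' <= action w q v)%E & forall t i k, `|q' t i k| <= M]) ->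
  (forall qn vn q v, (forall n, S (qn n)) -> uw_cvg qn vn q v -> S q) ->
  attains_min_on w S.
Proof.
move=> [p Sp] SL coer clos.
have [_ [vp dp]] := SL p Sp.
pose A := [set a | exists q v, [/\ S q, is_H1_deriv q v & a = action w q v]].
pose m := ereal_inf A.
have mlb q v : S q -> is_H1_deriv q v -> (m <= action w q v)%E.
  by move=> Sq dq; apply: ereal_inf_lbound; exists q, v.
have act0 q v : is_H1_deriv q v -> (0 <= action w q v)%E.
  move=> dq; rewrite action_split// adde_ge0//.
    rewrite lee_fin /kinetic mulr_ge0// sumr_ge0// => i _; rewrite sumr_ge0// => k _.
    exact: ip_ge0.
  by apply: integral_ge0 => t _; exact: Upot_ge0.
have m0 : (0 <= m)%E.
  by apply: le_ereal_inf_tmp => _ [q [v [_ dq ->]]]; exact: act0.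
(* With an infinite infimum any element is a minimiser, so no loop of finite action has to be
   exhibited. *)
have [my|mfin] := eqVneq m +oo%E.
  exists p, vp; split => //; split => // q v Sq dq.
  by have := mlb q v Sq dq; rewrite my leye_eq => /eqP ->; exact: leey.
have mf : m \is a fin_num by rewrite ge0_fin_numE// lt_neqAle mfin leey.
pose c n : R := fine m + n.+1%:R^-1.
have c1 n : c n <= fine m + 1.
  by rewrite lerD2l invf_le1// ?ltr0n// ler1n.
have [M coerM] := coer (fine m + 1).
have ex n : exists z : path * path, [/\ S z.1, is_H1_deriv z.1 z.2,
    (action w z.1 z.2 <= (c n)%:E)%E & forall t i k, `|z.1 t i k| <= M].
  have n0 : 0 < n.+1%:R^-1 :> R by rewrite invr_gt0.
  have [_ [q [v [Sq dq ->]]] lt] := lb_ereal_inf_adherent n0 mf.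
  have le : (action w q v <= (c n)%:E)%E.
    by apply: le_trans (ltW lt) _; rewrite -/m /c EFinD fineK.
  have [|q' [v' [Sq' dq' aq' qM]]] := coerM q v Sq dq.
    by apply: le_trans le _; rewrite lee_fin.
  by exists (q', v'); split => //; exact: le_trans le.
have [z zP] := choice ex.
have dz n : is_H1_deriv (z n).1 (z n).2 by case: (zP n).
have zM n t i k : `|(z n).1 t i k| <= M by case: (zP n).
have perz n t : (z n).1 (t + T) = (z n).1 t.
  by have [/SL[per _] _ _ _] := zP n; exact: per.
have velz n i k : nrm2 (component (z n).2 i k) <=
    4 * (fine m + 1) + 2 * (w ^+ 2 * (M ^+ 2 * T)).
  apply: vel_bound => //; have [_ _ le _] := zP n; apply: le_trans le _.
  by rewrite lee_fin.
have [phi [q [v [phik uw]]]] := uw_compact dz perz zM velz.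
have Sq : S q by apply: clos uw => n; case: (zP (phi n)).
exists q, v; split => //; split; first by case: uw.
move=> q1 v1 Sq1 dq1; apply: le_trans (mlb q1 v1 Sq1 dq1).
rewrite -(fineK mf); apply: (uw_action_le uw (c := c)).
  move=> n; case: (zP (phi n)) => _ _ le _; apply: le_trans le _.
  rewrite lee_fin lerD2l lef_pV2 ?posrE ?ltr0n// ler_nat.
  exact: phik.
rewrite -[X in _ --> X]addr0; apply: cvgD; first exact: cvg_cst.
exact: cvg_harmonic.
Qed.

End DirectMethod.

(** * Closedness of the symmetries, the means and the classes *)

Section Closedness.
Context (R : realType) (N : nat).
Local Notation T := (T2pi R).
Local Notation mu := (@leb R).
Local Notation I := (@I0 R).
Local Notation L2 := (sqint mu I).
Local Notation ip := (ip mu I).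
Local Notation h1d := (h1d T).
Local Notation path := (Defs.path R N).
Implicit Types (q v p u h : path) (w : R).

Let T0 := T2pi_gt0 R.
Let mI : @measurable _ (measurableTypeR R) I := @measurable_J R T.
Let fI : (mu I < +oo)%E := finite_J T0.

Lemma cvg_eq (a b : nat -> R) (x y : R) : a @ \oo --> x -> b @ \oo --> y ->
  (forall n, a n = b n) -> x = y.
Proof.
move=> ax by_ /funext ab; rewrite ab in ax.
exact: (cvg_unique _ ax by_).
Qed.

Lemma LambdaDN_closed qn vn q v : (forall n, in_LambdaDN (qn n)) ->
  uw_cvg qn vn q v -> in_LambdaDN q.
Proof.
move=> Sn uw; have cv := uw_pointwise uw; have [_ dq _ _] := uw.
split; [split|split].
- move=> t; apply/funext => i; apply/funext => k.
  apply: (cvg_eq (cv (t + T) i k) (cv t i k)) => n.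
  by have [[per _] _] := Sn n; rewrite per.
- by exists v.
- move=> i j j0 t; apply/funext => k.
  apply: (cvg_eq (cv t i k) (cv (t + T * i%:R / N%:R) j k)) => n.
  by have [_ [sym _]] := Sn n; rewrite (sym i j j0 t).
- move=> j j0 t; split; [|split].
  + apply: (cvg_eq (cv (T - t) j cx) (cv t j cx)) => n.
    by have [_ [_ /(_ j j0 t)[]]] := Sn n.
  + apply: (cvg_eq (cv (T - t) j cy) (cvgN (cv t j cy))) => n.
    by have [_ [_ /(_ j j0 t)[_ []]]] := Sn n.
  + apply: (cvg_eq (cv (T - t) j cz) (cv t j cz)) => n.
    by have [_ [_ /(_ j j0 t)[_ []]]] := Sn n.
Qed.

Lemma mean_ip (f : R -> R) : mean f = 0 <-> ip f (cst 1) = 0.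
Proof.
rewrite /mean (_ : Rintegral mu I f = ip f (cst 1)); last first.
  by apply: eq_Rintegral => t _; rewrite mulr1.
split=> [/eqP|->]; last by rewrite mulr0.
by rewrite mulf_eq0 invr_eq0 gt_eqF//= => /eqP.
Qed.

Lemma mean0_closed k qn vn q v : (forall n, mean0_zero k (qn n)) ->
  uw_cvg qn vn q v -> mean0_zero k q.
Proof.
move=> Sn uw j j0; apply/mean_ip.
have c1 : L2 (cst 1) by exact: (sqint_cst mI fI).
have z n : ip (component (qn n) j k) (cst 1) = 0 by apply/mean_ip; exact: (Sn n).
exact: (@cvg_eq _ (fun=> 0) _ 0 (uw_weak0 uw c1) (cvg_cst _) z).
Qed.

Definition rip q v h hd : R := \sum_(i < N) \sum_(k < 3)
  (ip (component q i k) (component h i k) + ip (component v i k) (component hd i k)).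

Lemma H1innerE q v h hd : is_H1_deriv q v -> is_H1_deriv h hd ->
  H1inner q v h hd = (rip q v h hd)%:E.
Proof.
move=> dq dh.
have i1 i k : mu.-integrable I (EFin \o (fun t => q t i k * h t i k)).
  exact: (sqintM mI (H1_L2 i k dq) (H1_L2 i k dh)).
have i2 i k : mu.-integrable I (EFin \o (fun t => v t i k * hd t i k)).
  exact: (sqintM mI (H1_L2d i k dq) (H1_L2d i k dh)).
have i3 i k : mu.-integrable I
    (EFin \o (fun t => q t i k * h t i k + v t i k * hd t i k)).
  exact: (integrableD mI (i1 i k) (i2 i k)).
rewrite /H1inner integral_sumR; last by move=> i; exact: integrable_sumR.
congr EFin; apply: eq_bigr => i _.
rewrite {1}/Rintegral integral_sumR//=; apply: eq_bigr => k _.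
exact: RintegralD.
Qed.

Lemma H1_derivB q v p u : is_H1_deriv q v -> is_H1_deriv p u ->
  is_H1_deriv (fun t i k => q t i k - p t i k) (fun t i k => v t i k - u t i k).
Proof.
move=> /H1_derivP h1 /H1_derivP h2; apply/H1_derivP => i k.
exact: (h1dB T0 (h1 i k) (h2 i k)).
Qed.

Lemma H1_derivD q v p u : is_H1_deriv q v -> is_H1_deriv p u ->
  is_H1_deriv (fun t i k => q t i k + p t i k) (fun t i k => v t i k + u t i k).
Proof.
move=> /H1_derivP h1 /H1_derivP h2; apply/H1_derivP => i k.
exact: (h1dD T0 (h1 i k) (h2 i k)).
Qed.

Lemma ripB q v p u h hd : is_H1_deriv q v -> is_H1_deriv p u ->
  is_H1_deriv h hd ->
  rip (fun t i k => q t i k - p t i k) (fun t i k => v t i k - u t i k) h hd =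
  rip q v h hd - rip p u h hd.
Proof.
move=> dq dp dh; rewrite /rip -sumrB; apply: eq_bigr => i _.
rewrite -sumrB; apply: eq_bigr => k _.
have e1 := ipBl mI (H1_L2 i k dq) (H1_L2 i k dp) (H1_L2 i k dh).
have e2 := ipBl mI (H1_L2d i k dq) (H1_L2d i k dp) (H1_L2d i k dh).
transitivity ((ip (component q i k) (component h i k) - ip (component p i k) (component h i k)) +
  (ip (component v i k) (component hd i k) - ip (component u i k) (component hd i k)));
  last by ring.
by rewrite -e1 -e2.
Qed.

Lemma rip_unique q v v' h hd : is_H1_deriv q v -> is_H1_deriv q v' ->
  is_H1_deriv h hd -> rip q v h hd = rip q v' h hd.
Proof.
move=> dq dq' dh; apply: eq_bigr => i _; apply: eq_bigr => k _.
congr (_ + _); move/H1_derivP : dq => /(_ i k) h1.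
move/H1_derivP : dq' => /(_ i k) h2.
exact: (h1d_unique T0 h1 h2 (H1_L2d i k dh)).
Qed.

Lemma uw_rip qn vn q v h hd : uw_cvg qn vn q v -> is_H1_deriv h hd ->
  rip (qn n) (vn n) h hd @[n --> \oo] --> rip q v h hd.
Proof.
move=> uw dh; have [_ _ _ wv] := uw; apply: cvg_sumR => i; apply: cvg_sumR => k.
by apply: cvgD; [apply: uw_weak0 uw _; exact: H1_L2 dh|apply: wv; exact: H1_L2d dh].
Qed.

(** For finitely many test loops, some [qn n] is within [eps / 2] of [q] and some element of [S]
    within [eps / 2] of that [qn n]. *)
Lemma weak_closure_closed (S : set path) qn vn q v :
  (forall n, weak_closure S (qn n)) -> uw_cvg qn vn q v -> weak_closure S q.
Proof.
move=> Sn uw; have [dqn dq _ _] := uw; exists v; split => // m h hd eps eps0 hP.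
have eps2 : 0 < eps / 2 by rewrite divr_gt0.
have nearn : \forall n \near \oo, forall j : 'I_m,
    `|rip q v (h j) (hd j) - rip (qn n) (vn n) (h j) (hd j)| < eps / 2.
  apply: filter_forall => j.
  by have /cvgrPdist_lt/(_ _ eps2) := uw_rip uw (hP j).2.
have [n nP] := filter_ex nearn.
(* The closure brings its own derivative [v'] of [qn n]; [rip_unique] exchanges it for [vn n]. *)
have [v' [dv' cl]] := Sn n.
have [p [u [Sp [dp pP]]]] := cl m h hd _ eps2 hP.
exists p, u; split => //; split => // j.
have := pP j; have := nP j; have dh := (hP j).2.
rewrite !H1innerE//; [|exact: H1_derivB..].
rewrite !ripB// /abse !lte_fin (rip_unique (dqn n) dv' dh).
move: (rip q _ _ _) (rip (qn n) _ _ _) (rip p _ _ _) => a b c h1 h2.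
rewrite (_ : a - c = (a - b) + (b - c)); last by ring.
apply: le_lt_trans (ler_normD _ _) _; lra.
Qed.

Lemma weak_closure_self (S : set path) q v : is_H1_deriv q v -> S q ->
  weak_closure S q.
Proof.
move=> dq Sq; exists v; split => // m h hd eps eps0 hP; exists q, v; split => //.
split=> // j; rewrite H1innerE ?ripB//; [|exact: (hP j).2|exact: H1_derivB|exact: (hP j).2].
by rewrite subrr abse0 lte_fin.
Qed.

(** Weak neighbourhoods test only differences of paths, in which a common translation cancels. *)
Lemma weak_closure_translate (S : set path) q p u : is_H1_deriv p u ->
  (forall r, S r -> S (fun t i k => r t i k + p t i k)) ->
  weak_closure S q -> weak_closure S (fun t i k => q t i k + p t i k).
Proof.
move=> dp Sp [v [dq cl]]; exists (fun t i k => v t i k + u t i k).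
split; first exact: H1_derivD.
move=> m h hd eps eps0 hP; have [r [s [Sr [dr rP]]]] := cl m h hd eps eps0 hP.
exists (fun t i k => r t i k + p t i k), (fun t i k => s t i k + u t i k).
split; first exact: Sp.
split; first exact: H1_derivD.
move=> j; have := rP j; congr (`|_| < _)%E; apply: eq_integral => t _.
congr EFin; apply: eq_bigr => i _; apply: eq_bigr => k _; ring.
Qed.

Lemma LambdaDN_xi_closed xi qn vn q v : (forall n, LambdaDN_xi xi (qn n)) ->
  uw_cvg qn vn q v -> LambdaDN_xi xi q.
Proof.
move=> Sn uw; split.
  by apply: LambdaDN_closed uw => n; have [] := Sn n.
by apply: weak_closure_closed uw => n; have [] := Sn n.
Qed.

End Closedness.

(** * Periodicity of sine and cosine *)

Section Trigonometry.
Context (R : realType).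
Local Notation T := (T2pi R).

Lemma cos_shift n (x : R) : cos (x + n%:R * T) = cos x.
Proof.
elim: n => [|n ih]; first by rewrite mul0r addr0.
by rewrite -natr1 mulrDl mul1r addrA [X in _ (_ + X)](_ : T = pi *+ 2) ?cosD2pi // /T2pi mulr_natl.
Qed.

Lemma sin_shift n (x : R) : sin (x + n%:R * T) = sin x.
Proof.
elim: n => [|n ih]; first by rewrite mul0r addr0.
by rewrite -natr1 mulrDl mul1r addrA [X in _ (_ + X)](_ : T = pi *+ 2) ?sinD2pi // /T2pi mulr_natl.
Qed.

Lemma sin_natpi n : sin (n%:R * pi) = 0 :> R.
Proof.
elim: n => [|n ih]; first by rewrite mul0r sin0.
by rewrite -natr1 mulrDl mul1r sinDpi ih oppr0.
Qed.

(** Only the fractional part [r] of [w] matters, and [cos (2 pi r) = 1 - 2 sin^2 (pi r)]. This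
    serves both coercivity and the separation of the bodies on the explicit loop. *)
Lemma cos_T2pi_lt1 (w : R) : 0 <= w -> (forall z : int, w != z%:~R) ->
  cos (w * T) < 1.
Proof.
move=> w0 wZ; have /andP[h1 h2] := truncn_itv w0.
move: h1 h2; set n := Num.truncn w => h1 h2.
have r0 : 0 < w - n%:R.
  by rewrite lt_neqAle subr_ge0 h1 andbT eq_sym subr_eq0; exact: (wZ n).
have -> : w * T = (w - n%:R) * T + n%:R * T by ring.
rewrite cos_shift; set r := w - n%:R.
have r1 : r < 1 by rewrite /r; move: h2; rewrite -natr1; lra.
have -> : r * T = r * pi + r * pi by rewrite /T2pi; ring.
have s0 : 0 < sin (r * pi).
  apply: sin_gt0_pi; rewrite mulr_gt0 ?pi_gt0//=.
  by rewrite -[X in _ < X]mul1r ltr_pM2r// pi_gt0.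
rewrite cosD -!expr2 cos2sin2; have := exprn_gt0 2 s0; lra.
Qed.

End Trigonometry.

(** * A priori bounds for symmetric loops, and the translation at [w = N] *)

Section Coercivity.
Context (R : realType) (N : nat).
Local Notation T := (T2pi R).
Local Notation mu := (@leb R).
Local Notation I := (@I0 R).
Local Notation L2 := (sqint mu I).
Local Notation ip := (ip mu I).
Local Notation nrm2 f := (ip f%R f%R).
Local Notation h1d := (h1d T).
Local Notation path := (Defs.path R N).
Implicit Types (q v p u h : path) (w : R).

Let T0 := T2pi_gt0 R.
Let mI : @measurable _ (measurableTypeR R) I := @measurable_J R T.
Let fI : (mu I < +oo)%E := finite_J T0.

(** The number [- f 0] is the mean of [f - f 0]. *)
Lemma mean_zero_bound (f : R -> R) (B : R) : L2 f -> mean f = 0 ->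
  (forall t, 0 <= t -> t <= T -> `|f t - f 0| <= B) -> `|f 0| <= B.
Proof.
move=> sf /mean_ip f0 fB.
have B0 : 0 <= B by exact: le_trans (fB 0 (lexx 0) (ltW T0)).
have s1 : L2 (cst 1) by exact: (sqint_cst mI fI).
have sc : L2 (cst (f 0)) by exact: (sqint_cst mI fI).
have sd : L2 (fun t => f t - f 0) by exact: (sqintB mI sf sc).
have e : ip (fun t => f t - f 0) (cst 1) = - (f 0 * T).
  have := ipBl mI sf sc s1; rewrite f0 sub0r => ->; congr (- _).
  rewrite -Rintegral_cst_I0; apply: eq_Rintegral => t _; exact: mulr1.
have n1 : nrm2 (cst 1) <= 1 ^+ 2 * T.
  by apply: nrm2_le_bound => // t _ _; rewrite normr1.
have n2 : nrm2 (fun t => f t - f 0) <= B ^+ 2 * T by exact: nrm2_le_bound.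
have := ip_cauchy_schwarz mI sd s1; rewrite e sqrrN => cs.
have : (f 0 * T) ^+ 2 <= (B * T) ^+ 2.
  apply: le_trans cs _.
  rewrite (_ : (B * T) ^+ 2 = (B ^+ 2 * T) * (1 ^+ 2 * T)); last by ring.
  by apply: ler_pM => //; exact: ip_ge0.
move=> /norm_le_sqrt; rewrite sqrtr_sqr (normrM (f 0)) (normrM B) (ger0_norm B0) (ger0_norm (ltW T0)).
by rewrite ler_pM2r.
Qed.

Variables (o : 'I_N) (o0 : nat_of_ord o = 0%N).

Lemma LambdaDN_y0 q : in_LambdaDN q -> q 0 o cy = 0.
Proof.
move=> [[per _] [_ /(_ o o0 0)[_ [y _]]]].
move: y; rewrite subr0 -[X in q X o cy = _]add0r per; lra.
Qed.

Lemma LambdaDN_bound q (M : R) : in_LambdaDN q ->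
  (forall t k, 0 <= t -> t <= T -> `|q t o k| <= M) ->
  forall t i k, `|q t i k| <= M.
Proof.
move=> [[per _] [sym _]] qM t i k; rewrite (sym i o o0).
have [s [s0 sT ->]] := periodic_reduce (t + T * i%:R / N%:R) per.
exact: qM.
Qed.

Definition rotB (w K : R) : R := 2 * Num.sqrt (K * T) * (1 + w * T).

(** The real and imaginary parts of [e^{iwt} zeta(t) - zeta(0)] for body 0. The second is the first
    for [- i zeta = y - i x], and [y(0) = 0]. *)
Lemma loop_rotating_bound w q v (K : R) : in_LambdaDN q -> is_H1_deriv q v ->
  0 <= w -> (forall k, nrm2 (res w q v o k) <= K) ->
  forall t, 0 <= t -> t <= T ->
  `|cos (w * t) * q t o cx - sin (w * t) * q t o cy - q 0 o cx| <= rotB w K /\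
  `|cos (w * t) * q t o cy + sin (w * t) * q t o cx| <= rotB w K.
Proof.
move=> LN dq w0 rK t t0 tT; have /H1_derivP hd := dq.
have hx := hd o cx; have hy := hd o cy.
split.
  exact: (rotating_bound T0 hx hy w0 (rK cx) (rK cy) t0 tT).
have Kb : nrm2 (fun t => - component v o cx t + w * component q o cy t) <= K.
  apply: le_trans (rK cx); rewrite le_eqVlt; apply/orP; left; apply/eqP.
  by apply: eq_Rintegral => s _; rewrite /res /component /=; ring.
have Ka : nrm2 (fun t => component v o cy t - w * - component q o cx t) <= K.
  apply: le_trans (rK cy); rewrite le_eqVlt; apply/orP; left; apply/eqP.
  by apply: eq_Rintegral => s _; rewrite /res /component /=; ring.
have := rotating_bound T0 hy (h1dN T0 hx) w0 Ka Kb t0 tT.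
by rewrite /component (LambdaDN_y0 LN) subr0 mulrN opprK.
Qed.

(** Undoing the rotation bounds the planar coordinates, leaving [x(0)] as the only free quantity.
    For [z] the two copies of [rotB] are the oscillation and, by the vanishing mean, [z(0)]. *)
Lemma loop_bound w q v (K : R) : in_LambdaDN q -> is_H1_deriv q v ->
  0 <= w -> (forall k, nrm2 (res w q v o k) <= K) -> mean0_zero cz q ->
  forall t i k, `|q t i k| <= `|q 0 o cx| + 2 * rotB w K.
Proof.
move=> LN dq w0 rK mz; apply: LambdaDN_bound => // t k t0 tT.
have [h1 h2] := loop_rotating_bound LN dq w0 rK t0 tT.
have x0 := normr_ge0 (q 0 o cx).
have m0 : 0 <= Num.sqrt (K * T) by exact: sqrtr_ge0.
have wT : 0 <= w * T by rewrite mulr_ge0// ltW.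
have mB : Num.sqrt (K * T) <= rotB w K.
  have -> : rotB w K = Num.sqrt (K * T) * (2 * (1 + w * T)) by rewrite /rotB; ring.
  by rewrite ler_peMr//; lra.
set c := cos (w * t); set s := sin (w * t).
have cs : c ^+ 2 + s ^+ 2 = 1 by exact: cos2Dsin2.
have c1 : `|c| <= 1 by rewrite ler_norml cos_geN1 cos_le1.
have s1 : `|s| <= 1 by rewrite ler_norml sin_geN1 sin_le1.
rewrite -/c -/s in h1 h2.
set x := q t o cx in h1 h2 *; set y := q t o cy in h1 h2 *.
have h1' : `|c * x - s * y| <= `|q 0 o cx| + rotB w K.
  rewrite -[c * x - s * y](subrK (q 0 o cx)) addrC.
  by apply: le_trans (ler_normD _ _) _; rewrite lerD2l.
have comb (a b p r : R) : `|a| <= 1 -> `|b| <= 1 ->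
    `|p| <= `|q 0 o cx| + rotB w K -> `|r| <= rotB w K ->
    `|a * p + b * r| <= `|q 0 o cx| + 2 * rotB w K.
  move=> a1 b1 pB rB; apply: le_trans (ler_normD _ _) _; rewrite !normrM.
  rewrite (_ : `|q 0 o cx| + 2 * rotB w K =
    1 * (`|q 0 o cx| + rotB w K) + 1 * rotB w K); last by ring.
  by apply: lerD; apply: ler_pM.
have [kx|kx] := eqVneq k cx.
  rewrite kx -/x (_ : x = c * (c * x - s * y) + s * (c * y + s * x)).
    exact: comb.
  by rewrite -[LHS]mul1r -cs; ring.
have [ky|ky] := eqVneq k cy.
  rewrite ky -/y (_ : y = (- s) * (c * x - s * y) + c * (c * y + s * x)).
    by apply: comb => //; rewrite normrN.
  by rewrite -[LHS]mul1r -cs; ring.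
have kz : k = cz.
  apply/val_inj; move: kx ky (ltn_ord k); rewrite -!val_eqE /=.
  by case: (nat_of_ord k) => [|[|[|]]].
have /H1_derivP /(_ o cz) hz := dq.
have osc s' : 0 <= s' -> s' <= T -> `|q s' o cz - q 0 o cz| <= rotB w K.
  move=> s0 sT; apply: le_trans mB; apply: norm_le_sqrt.
  apply: le_trans (h1d_osc T0 hz (lexx 0) s0 sT) _; rewrite subr0.
  by apply: ler_pM => //; [exact: ip_ge0|exact: (rK cz)].
have z0 : `|q 0 o cz| <= rotB w K.
  apply: (@mean_zero_bound (component q o cz)) => //; first exact: H1_L2 dq.
  exact: mz.
rewrite kz -[q t o cz](subrK (q 0 o cz)).
apply: le_trans (ler_normD _ _) _; have := osc t t0 tT; lra.
Qed.

(* The solution [c e^{-iwt}] of [zeta' + i w zeta = 0], given to every body. *)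
Definition rot (w c : R) : path := fun t i k =>
  if k == cx then c * cos (w * t) else if k == cy then - c * sin (w * t) else 0.

Definition drot (w c : R) : path := fun t i k =>
  if k == cx then - (c * w) * sin (w * t)
  else if k == cy then - (c * w) * cos (w * t) else 0.

Local Notation "q :+ p" := (fun t i k => q t i k + p t i k) (at level 50).

Lemma rot_H1 w c : is_H1_deriv (rot w c) (drot w c).
Proof.
apply/H1_derivP => i k.
have hc : h1d (fun t => cos (w * t)) (fun t => - w * sin (w * t)).
  apply: h1d_C1 => // [t|]; last first.
    by move=> t; apply: cvgM; [exact: cvg_cst|exact: continuous_sin_mul].
  by apply: (is_derive_eq (is_derive_cos_mul w t)); rewrite mulNr.
have hs : h1d (fun t => sin (w * t)) (fun t => w * cos (w * t)).
  apply: h1d_C1 => // [t|]; first exact: is_derive_sin_mul.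
  by move=> t; apply: cvgM; [exact: cvg_cst|exact: continuous_cos_mul].
have h0 : h1d (fun=> 0) (fun=> 0).
  have := h1dZ T0 0 hc; congr h1d; apply/funext => t; ring.
rewrite /component /rot /drot; case: (k == cx).
  by have := h1dZ T0 c hc; congr h1d; apply/funext => t; ring.
case: (k == cy) => //.
by have := h1dZ T0 (- c) hs; congr h1d; apply/funext => t; ring.
Qed.

(** The added mode has zero residual, and moving all bodies by the same vector preserves the
    distances. *)
Lemma action_rot w c q v : action w (q :+ rot w c) (v :+ drot w c) = action w q v.
Proof.
apply: eq_integral => t _; congr (_ + _)%E.
  congr (_ * _)%:E; apply: eq_bigr => i _.
  by rewrite /rot /drot /=; congr (_ ^+ 2 + _ ^+ 2 + _ ^+ 2); ring.
have d i j : dist ((q :+ rot w c) t) i j = dist (q t) i j.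
  by rewrite /dist; congr Num.sqrt; apply: eq_bigr => k _; congr (_ ^+ 2); rewrite /rot; ring.
by rewrite /Upot; apply: eq_bigr => i _; apply: eq_bigr => j _; rewrite !d.
Qed.

Section TranslationByN.
Hypothesis N0 : (0 < N)%N.
Local Notation w := (N%:R : R).

Let Nne0 : w != 0. Proof. by rewrite pnatr_eq0 -lt0n. Qed.

(** The mode [e^{-iNt}] has period [2 pi / N], so the time shifts between the bodies do not change
    it; the reflection is respected because [c] is real. *)
Lemma rot_LambdaDN c q : in_LambdaDN q -> in_LambdaDN (q :+ rot w c).
Proof.
move=> [[per [v dq]] [sym refl]]; split; [split|split].
- move=> t; apply/funext => i; apply/funext => k; rewrite per; congr (_ + _).
  by rewrite /rot mulrDr cos_shift sin_shift.
- by exists (v :+ drot w c); apply: H1_derivD => //; exact: rot_H1.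
- move=> i j j0 t; apply/funext => k; rewrite (sym i j j0 t); congr (_ + _).
  rewrite /rot; have -> : w * (t + T * i%:R / w) = w * t + i%:R * T by field.
  by rewrite cos_shift sin_shift.
- move=> j j0 t; have [hx [hy hz]] := refl j j0 t.
  have e : w * (T - t) = - (w * t) + w * T by ring.
  rewrite hx hy hz /rot /= e cos_shift sin_shift cosN sinN.
  by split => //; split => //; ring.
Qed.

(** The signs are read at the times [k pi / N], exactly where [sin (N t)] vanishes. *)
Lemma rot_LambdaDN_xi c xi q : LambdaDN_xi xi q -> LambdaDN_xi xi (q :+ rot w c).
Proof.
move=> [LN wc]; split; first exact: rot_LambdaDN.
apply: weak_closure_translate wc; first exact: rot_H1.
move=> r [Lr [cf sg]]; split; first exact: rot_LambdaDN.
split=> [t i j ij|j k j0].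
  have [k rk] := cf t i j ij; exists k; apply: contra rk => /eqP h; apply/eqP.
  by move: h; rewrite /rot; exact: addIr.
rewrite -(sg j k j0); congr Num.sg; rewrite /rot /=.
have -> : w * (k.+1%:R * pi / w) = k.+1%:R * pi by field.
by rewrite sin_natpi mulr0 addr0.
Qed.

Lemma rot_mean0 c k q v : is_H1_deriv q v -> k != cy ->
  mean0_zero k q -> mean0_zero k (q :+ rot w c).
Proof.
move=> dq ky mq j j0; have /mean_ip q0 := mq j j0; apply/mean_ip.
have s1 : L2 (cst 1) by exact: (sqint_cst mI fI).
have := ipDl mI (H1_L2 j k dq) (H1_L2 j k (rot_H1 w c)) s1.
rewrite [X in X + _]q0 add0r => -> {q0}.
rewrite /component /rot; case: (k == cx); last first.
  rewrite (negbTE ky) (_ : ip _ _ = Rintegral mu I (cst 0)).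
    by rewrite Rintegral_cst_I0 mul0r.
  by apply: eq_Rintegral => t _; rewrite mul0r.
have hs : h1d (fun t => c / w * sin (w * t)) (fun t => c / w * (w * cos (w * t))).
  apply: h1dZ => //; apply: h1d_C1 => // [t|]; first exact: is_derive_sin_mul.
  by move=> t; apply: cvgM; [exact: cvg_cst|exact: continuous_cos_mul].
have [_ /(_ 0 T (lexx 0) (ltW T0) (lexx T))] := hs.
rewrite -[w * T]add0r sin_shift mulr0 sin0 mulr0 subrr => <-.
by apply: eq_Rintegral => t _; rewrite mulr1; field.
Qed.

End TranslationByN.

End Coercivity.

(** * Interpolation and multiple angles *)

Section Interpolation.
Context (R : realType).

Lemma poly_interpolation n (x y : 'I_n -> R) : injective x ->
  exists P : {poly R}, forall k, P.[x k] = y k.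
Proof.
move=> xinj.
exists (\sum_k y k *: \prod_(j | j != k) ((x k - x j)^-1 *: ('X - (x j)%:P))) => k.
have xne j : j != k -> x k - x j != 0.
  by apply: contraNneq => /eqP; rewrite subr_eq0 => /eqP/xinj ->.
rewrite horner_sum (bigD1 k)//= [X in _ + X]big1 ?addr0.
  rewrite hornerZ horner_prod big1 ?mulr1// => j jk.
  by rewrite hornerZ !hornerE mulVf// xne.
move=> l lk; rewrite hornerZ horner_prod (bigD1 k); last by rewrite eq_sym.
rewrite [X in _ * X](_ : _ = 0) ?mulr0//=.
by rewrite !hornerE subrr mulr0 mul0r.
Qed.

(** Angles with the same cosine are opposite or equal modulo a turn; the sign [e] records which, and
    multiples inherit it. *)
Lemma cos_sin_natmul (e x y : R) n : e ^+ 2 = 1 -> cos x = cos y ->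
  sin x = e * sin y ->
  cos (n%:R * x) = cos (n%:R * y) /\ sin (n%:R * x) = e * sin (n%:R * y).
Proof.
move=> e2 cxy sxy; elim: n => [|n [ihc ihs]]; first by rewrite !mul0r sin0 mulr0.
rewrite -natr1 !mulrDl !mul1r !cosD !sinD ihc ihs cxy sxy; split; last by ring.
rewrite (_ : e * _ * _ = e ^+ 2 * (sin (n%:R * y) * sin y)); last by ring.
by rewrite e2 mul1r.
Qed.

Lemma sin_natmul0 N (th : R) : (0 < N)%N -> 0 < th -> th < pi ->
  sin (N%:R * th) = 0 ->
  exists n, [/\ (0 < n)%N, (n < N)%N & th = n%:R * pi / N%:R].
Proof.
move=> N0 th0 thpi s0; have pp := pi_gt0 R.
have NR : 0 < N%:R :> R by rewrite ltr0n.
have x0 : 0 <= N%:R * th / pi by rewrite divr_ge0 ?mulr_ge0 ?ltW.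
have /andP[] := truncn_itv x0; set n := Num.truncn _.
rewrite ler_pdivlMr// ltr_pdivrMr// => h1 h2.
have sg : forall m (z : R), sin z = 0 -> sin (z - m%:R * pi) = 0.
  elim=> [|m ih] z z0; first by rewrite mul0r subr0.
  have -> : z - m.+1%:R * pi = (z - pi) - m%:R * pi by rewrite -natr1; ring.
  by apply: ih; rewrite -[z](subrK pi) sinDpi in z0; rewrite -[LHS]opprK z0 oppr0.
have e : N%:R * th = n%:R * pi.
  apply/eqP; rewrite eq_le h1 andbT leNgt; apply/negP => lt.
  have := sg n _ s0; have : 0 < sin (N%:R * th - n%:R * pi).
    by apply: sin_gt0_pi; move: h2; rewrite -natr1 => h2; apply/andP; split; lra.
  by move=> /[swap] ->; rewrite ltxx.
exists n; split; last by rewrite -e mulrC mulKf// gt_eqF.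
  rewrite lt0n; apply: contraTneq (mulr_gt0 NR th0) => n0.
  by rewrite e n0 mul0r ltxx.
rewrite -(ltr_nat R) -(ltr_pM2r pp) -e ltr_pM2l//.
Qed.

End Interpolation.

(** * An explicit collision-free loop in each class *)

Section SeedLoop.
Context (R : realType) (N : nat).
Hypothesis N2 : (2 <= N)%N.
Local Notation T := (T2pi R).
Local Notation mu := (@leb R).
Local Notation I := (@I0 R).
Local Notation h1d := (h1d T).
Local Notation path := (Defs.path R N).
Variables (xi : 'I_N.-1 -> R) (xiP : sign_datum xi).

Let T0 := T2pi_gt0 R.
Let N0 : (0 < N)%N := ltnW N2.
Let NR : 0 < N%:R :> R. Proof. by rewrite ltr0n. Qed.

Definition node (n : nat) : R := n%:R * pi / N%:R.

Lemma ord_pred_lt (j : 'I_N.-1) : (j.+1 < N)%N.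
Proof. by have := ltn_ord j; rewrite -ltnS (prednK N0). Qed.

Lemma node_bounds n : (0 < n)%N -> (n < N)%N -> 0 < node n < pi.
Proof.
move=> n0 nN; have pp := pi_gt0 R; rewrite /node divr_gt0 ?mulr_gt0 ?ltr0n//=.
by rewrite ltr_pdivrMr// mulrC ltr_pM2l// ltr_nat.
Qed.

Lemma node_interpolation :
  exists P : {poly R}, forall k : 'I_N.-1, P.[cos (node k.+1)] = xi k.
Proof.
apply: (@poly_interpolation R _ (fun k : 'I_N.-1 => cos (node k.+1))) => k l.
have kN := ord_pred_lt.
have /andP[k1 k2] := node_bounds (ltn0Sn k) (kN k).
have /andP[l1 l2] := node_bounds (ltn0Sn l) (kN l).
move=> /cos_inj; rewrite !in_itv /= !ltW// => /(_ isT isT).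
have pN : pi / N%:R != 0 :> R by rewrite mulf_neq0 ?invr_neq0// gt_eqF ?pi_gt0.
rewrite /node -!mulrA => /(mulIf pN)/eqP; rewrite eqr_nat => /eqP[kl].
exact: val_inj.
Qed.

Variables (P : {poly R}) (PE : forall k : 'I_N.-1, P.[cos (node k.+1)] = xi k).

(** The odd factor [sin t] gives the reflection symmetry and is positive at the nodes, where [y]
    thus has the sign of [P]. The choice [x = cos t] leaves few candidates for a collision. *)
Definition seed0 (t : R) (k : 'I_3) : R :=
  if k == cx then cos t else if k == cy then sin t * P.[cos t] else 0.

Definition seed : path := fun t i => seed0 (t + T * i%:R / N%:R).

Lemma P_node_neq0 n : (0 < n)%N -> (n < N)%N -> P.[cos (node n)] != 0.
Proof.
case: n => // n _ nN.
have nN' : (n < N.-1)%N by rewrite -ltnS prednK.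
have := PE (Ordinal nN') => /= ->.
by case: (xiP (Ordinal nN')) => ->; rewrite ?oppr_eq0 oner_eq0.
Qed.

Lemma seed_H1 : exists v, is_H1_deriv seed v.
Proof.
pose d0 (k : 'I_3) (t : R) := if k == cx then - sin t
  else if k == cy then cos t * P.[cos t] - sin t * (P^`().[cos t] * sin t) else 0.
have dP (Q : {poly R}) (t : R) : is_derive t 1 (fun t => Q.[cos t]) (Q^`().[cos t] * - sin t).
  exact: (is_derive1_comp (is_derive_poly Q (cos t)) (is_derive_cos t)).
have cP (Q : {poly R}) : continuous (fun t : R => Q.[cos t]).
  move=> t; have [dd _] := dP Q t.
  by apply: differentiable_continuous; exact/derivable1_diffP.
have der k (t : R) : is_derive t 1 (seed0 ^~ k) (d0 k t).
  rewrite /seed0 /d0; case: (k == cx); first exact: is_derive_cos.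
  case: (k == cy); last exact: is_derive_cst.
  apply: (is_derive_eq (is_deriveM (is_derive_sin t) (dP P t))).
  by rewrite -![_ *: _]/(_ * _); ring.
have cont k : continuous (d0 k).
  rewrite /d0; case: (k == cx).
    by move=> t; apply: cvgN; exact: continuous_sin.
  case: (k == cy); last by move=> t; exact: cvg_cst.
  move=> t; apply: cvgB; first by apply: cvgM; [exact: continuous_cos|exact: cP].
  apply: cvgM; first exact: continuous_sin.
  by apply: cvgM; [exact: cP|exact: continuous_sin].
exists (fun t i k => d0 k (t + T * i%:R / N%:R)); apply/H1_derivP => i k.
set s := T * i%:R / N%:R.
have dsh (t : R) : is_derive t 1 (fun t : R => t + s) 1.
  apply: (is_derive_eq (is_deriveD (is_derive_id t 1) (is_derive_cst s t 1))).
  by rewrite addr0.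
apply: h1d_C1 => // [t|t].
  have := @is_derive1_comp R (seed0 ^~ k) (fun t => t + s) t _ _ (der k (t + s)) (dsh t).
  by rewrite mulr1.
apply: (@continuous_comp _ _ _ (fun t : R => t + s) (d0 k)); last exact: cont.
by apply: cvgD; [exact: cvg_id|exact: cvg_cst].
Qed.

Lemma seed_LambdaDN : in_LambdaDN seed.
Proof.
split; [split|split].
- move=> t; apply/funext => i; apply/funext => k; rewrite /seed.
  have -> : t + T + T * i%:R / N%:R = t + T * i%:R / N%:R + 1%:R * T by ring.
  by rewrite /seed0 cos_shift sin_shift.
- exact: seed_H1.
- move=> i j j0 t; rewrite /seed j0; congr seed0.
  by rewrite mulr0 mul0r addr0.
- move=> j j0 t; rewrite /seed j0 mulr0 mul0r !addr0 /seed0 /=.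
  have -> : T - t = - t + 1%:R * T by ring.
  by rewrite cos_shift sin_shift cosN sinN mulNr.
Qed.

Lemma cos_shift_lt1 (i j : nat) : (j < i)%N -> (i < N)%N ->
  cos (T * i%:R / N%:R - T * j%:R / N%:R) < 1.
Proof.
move=> ji iN.
have -> : T * i%:R / N%:R - T * j%:R / N%:R = (i - j)%:R / N%:R * T.
  by rewrite natrB ?(ltnW ji)//; ring.
have r0 : 0 < (i - j)%:R / N%:R :> R by rewrite divr_gt0// ltr0n subn_gt0.
apply: cos_T2pi_lt1; first exact: ltW.
move=> z; apply/negP => /eqP e.
have z0 : (0 < z)%R by rewrite -(ltr_int R) -e.
have : z%:~R < 1 :> R.
  rewrite -e ltr_pdivrMr// mul1r ltr_nat.
  exact: leq_ltn_trans (leq_subr _ _) iN.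
rewrite -[1]/(1%:~R) ltr_int => z1.
by have := lt_le_trans z1 z0; rewrite ltxx.
Qed.

(** Coinciding bodies at parameters [a], [b] have equal cosines. Equal sines are impossible, as [a]
    and [b] differ by a nonzero fraction of a turn. If the sines are opposite, equality of [y]
    forces [P.[cos a] = 0]. But [N a] and [N b] agree modulo [2 pi], so [sin (N a) = 0] and [cos a]
    is an interpolation node, where [P] is 1 or -1. *)
Lemma seed_collision_free : collision_free seed.
Proof.
move=> t i j ij; apply: contrapT => none.
have eq k : seed t i k = seed t j k.
  by apply/eqP; apply: contrapT => /negP h; apply: none; exists k.
set a := t + T * i%:R / N%:R; set b := t + T * j%:R / N%:R.
have ec : cos a = cos b by exact: (eq cx).
have es : sin a * P.[cos a] = sin b * P.[cos b] by exact: (eq cy).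
have nsin : sin a <> sin b.
  move=> sab.
  have c1 : cos (a - b) = 1 by rewrite cosB ec sab -!expr2 cos2Dsin2.
  have c2 : cos (b - a) = 1 by rewrite -cosN opprB.
  move: ij; rewrite -val_eqE /= neq_ltn => /orP[lt|lt].
    have := cos_shift_lt1 lt (ltn_ord j).
    by rewrite (_ : _ - _ = b - a) ?c2 ?ltxx// /a /b; ring.
  have := cos_shift_lt1 lt (ltn_ord i).
  by rewrite (_ : _ - _ = a - b) ?c1 ?ltxx// /a /b; ring.
have s2 : sin a ^+ 2 = sin b ^+ 2 by rewrite !sin2cos2 ec.
have sN : sin b = - sin a.
  by move/eqP: s2; rewrite eqf_sqr => /orP[/eqP//|/eqP ->]; rewrite opprK.
have sa0 : sin a != 0.
  by apply/eqP => sa0; apply: nsin; rewrite sN sa0 oppr0.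
have Pa0 : P.[cos a] = 0.
  move: es; rewrite sN -ec mulNr => /eqP; rewrite -addr_eq0 -mulr2n mulrn_eq0 /=.
  by rewrite mulf_eq0 (negbTE sa0) => /eqP.
have sNa : sin (N%:R * a) = 0.
  have [_ h] : cos (N%:R * b) = cos (N%:R * a) /\ sin (N%:R * b) = -1 * sin (N%:R * a).
    by apply: cos_sin_natmul; rewrite ?sqrrN ?expr1n ?mulN1r ?ec.
  have ea : N%:R * a = N%:R * t + i%:R * T by rewrite /a; field; rewrite gt_eqF.
  have eb : N%:R * b = N%:R * t + j%:R * T by rewrite /b; field; rewrite gt_eqF.
  move: h; rewrite ea eb !sin_shift; lra.
(* [acos] picks the representative of [+-a] in [0, pi]. *)
pose th : R := acos (cos a).
have c1 : -1 <= cos a <= 1 by rewrite cos_geN1 cos_le1.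
have cth : cos th = cos a by rewrite /th acosK// in_itv.
have sth : sin th = `|sin a| by rewrite /th sin_acos// -sin2cos2 sqrtr_sqr.
have sth0 : 0 < sin th by rewrite sth normr_gt0.
have th0 : 0 < th.
  rewrite lt_neqAle acos_ge0// andbT; apply/eqP => e.
  by move: sth0; rewrite -e sin0 ltxx.
have thpi : th < pi.
  rewrite lt_neqAle acos_lepi// andbT; apply/eqP => e.
  by move: sth0; rewrite e sinpi ltxx.
have sNth : sin (N%:R * th) = 0.
  have [_ ->] : cos (N%:R * th) = cos (N%:R * a) /\
      sin (N%:R * th) = Num.sg (sin a) * sin (N%:R * a).
    apply: cos_sin_natmul => //; last by rewrite sth normrEsg.
    by rewrite sqr_sg sa0.
  by rewrite sNa mulr0.
have [n [n0 nN e]] := sin_natmul0 N0 th0 thpi sNth.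
by have := P_node_neq0 n0 nN; rewrite /node -e cth Pa0 eqxx.
Qed.

Lemma seed_has_signs : has_signs xi seed.
Proof.
move=> j k j0; rewrite /seed j0 mulr0 mul0r addr0 /seed0 /=.
rewrite -/(node k.+1) PE sgrM gtr0_sg ?mul1r.
  by case: (xiP k) => ->; rewrite ?sgrN sgr1.
apply/sin_gt0_pi/node_bounds => //.
exact: ord_pred_lt.
Qed.

Lemma seed_LambdaDN_xi : LambdaDN_xi xi seed.
Proof.
split; first exact: seed_LambdaDN.
have [v dv] := seed_H1; apply: (weak_closure_self dv).
split; first exact: seed_LambdaDN.
by split; [exact: seed_collision_free|exact: seed_has_signs].
Qed.

Lemma seed_mean_x : mean0_zero cx seed.
Proof.
move=> j j0; apply/mean_ip; rewrite /seed j0.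
have hs : h1d sin cos by apply: h1d_C1 => // t; exact: continuous_cos.
have [_ /(_ 0 T (lexx 0) (ltW T0) (lexx T))] := hs.
rewrite (_ : sin T = 0); last first.
  by have := sin_shift 1 (0 : R); rewrite add0r mul1r sin0.
rewrite sin0 subrr => <-; apply: eq_Rintegral => t _.
by rewrite mulr1 mulr0 mul0r addr0.
Qed.

Lemma seed_mean_z : mean0_zero cz seed.
Proof.
move=> j j0; apply/mean_ip; rewrite -[RHS](mul0r T) -Rintegral_cst_I0.
by apply: eq_Rintegral => t _; rewrite mulr1.
Qed.

End SeedLoop.

Theorem mainTheorem3 (R : realType) (N : nat) (w : R) (xi : 'I_N.-1 -> R) :
  (2 <= N)%N -> 0 <= w -> w <= N%:R -> sign_datum xi ->
  ((forall z : int, w != z%:~R) ->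
     attains_min_on w (fun q => LambdaDN_xi xi q /\ mean0_zero cz q))
  /\
  ((w = 0 \/ w = N%:R) ->
     attains_min_on w (fun q => LambdaDN_xi xi q /\ mean0_zero cx q /\
                                  mean0_zero cz q)).
Proof.
move=> N2 w0 _ xiP.
have N0 : (0 < N)%N := ltnW N2.
pose o : 'I_N := Ordinal N0.
have o0 : nat_of_ord o = 0%N by [].
have T0 := T2pi_gt0 R.
have [P PE] := node_interpolation N2 xi.
have Sx := seed_LambdaDN_xi N2 xiP PE.
have mx := @seed_mean_x R N P; have mz := @seed_mean_z R N P.
(* The kinetic part carries a factor 1/2, hence [2 * C] for the residuals. *)
pose B (C : R) := rotB w (2 * C).
have resB C q v : is_H1_deriv q v -> (action w q v <= C%:E)%E ->
    forall k, ip (@leb R) (@I0 R) (res w q v o k) (res w q v o k) <= 2 * C.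
  by move=> dq ac k; exact: res_le_action.
split.
  move=> wZ; apply: direct_method.
  - by exists (seed P).
  - by move=> q [[[]]].
  (* After a full period the loop closes up, and with [y(0) = 0] the rotating estimate becomes
     [(1 - cos (2 pi w)) |x(0)| <= B C]. *)
  - move=> C; exists (B C / (1 - cos (w * T2pi R)) + 2 * B C).
    move=> q v [Lq mq] dq ac; exists q, v; split => // t i k.
    have [LN _] := Lq; have rK := resB C q v dq ac.
    apply: le_trans (loop_bound o0 LN dq w0 rK mq t i k) _.
    rewrite lerD2r.
    have c0 : 0 < 1 - cos (w * T2pi R) by rewrite subr_gt0; exact: cos_T2pi_lt1.
    have [h _] := loop_rotating_bound o0 LN dq w0 rK (ltW T0) (lexx _).
    have qT : q (T2pi R) = q 0 by have [[per _] _] := LN; rewrite -[T2pi R]add0r per.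
    move: h; rewrite qT (LambdaDN_y0 o0 LN) mulr0 subr0.
    rewrite (_ : _ - _ = - ((1 - cos (w * T2pi R)) * q 0 o cx)); last by ring.
    by rewrite normrN normrM (gtr0_norm c0) ler_pdivlMr// mulrC.
  - move=> qn vn q v Sn uw; split.
      by apply: LambdaDN_xi_closed uw => n; have [] := Sn n.
    by apply: mean0_closed uw => n; have [] := Sn n.
move=> wE; apply: direct_method.
- by exists (seed P).
- by move=> q [[[]]].
(* The first [B C] bounds [|x(0)|] when [w = 0], where the frame does not rotate and the mean
   applies; when [w = N] the translated loop has [x(0) = 0]. *)
- move=> C; exists (B C + 2 * B C) => q v [Lq [mqx mqz]] dq ac.
  case: wE => wE.
    exists q, v; split => // t i k.
    have [LN _] := Lq; have rK := resB C q v dq ac.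
    apply: le_trans (loop_bound o0 LN dq w0 rK mqz t i k) _.
    rewrite lerD2r; apply: (@mean_zero_bound R (component q o cx)).
    + exact: H1_L2 dq.
    + exact: mqx.
    + move=> s s0 sT; have [h _] := loop_rotating_bound o0 LN dq w0 rK s0 sT.
      by move: h; rewrite {1 2}wE mul0r cos0 sin0 mul1r mul0r subr0.
  pose c := - q 0 o cx.
  pose q' : Defs.path R N := fun t i k => q t i k + rot w c t i k.
  pose v' : Defs.path R N := fun t i k => v t i k + drot w c t i k.
  have dr : is_H1_deriv q' v' := H1_derivD dq (@rot_H1 R N w c).
  have aq : action w q' v' = action w q v := @action_rot R N w c q v.
  have Lq' : LambdaDN_xi xi q' by rewrite /q' wE; exact: rot_LambdaDN_xi.
  have mx' : mean0_zero cx q' by rewrite /q' wE; exact: rot_mean0 dq _ mqx.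
  have mz' : mean0_zero cz q' by rewrite /q' wE; exact: rot_mean0 dq _ mqz.
  exists q', v'; split => //; first by rewrite aq.
  move=> t i k; have [LN _] := Lq'.
  have ac' : (action w q' v' <= C%:E)%E by rewrite aq.
  apply: le_trans (loop_bound o0 LN dr w0 (resB C _ _ dr ac') mz' t i k) _.
  rewrite lerD2r /q' /rot /= mulr0 cos0 mulr1 /c subrr normr0.
  apply: mulr_ge0; first by apply: mulr_ge0 => //; exact: sqrtr_ge0.
  by apply: addr_ge0 => //; apply: mulr_ge0 => //; exact: ltW.
- move=> qn vn q v Sn uw; split.
    by apply: LambdaDN_xi_closed uw => n; have [] := Sn n.
  by split; apply: mean0_closed uw => n; have [_ []] := Sn n.
Qed.
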